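(* Let $(X_i,Y_i,Z_i)_{i\ge1}$ be i.i.d. copies of $(X,Y,Z)$. For each $n$ let $\hat p^*(x,y,z)=\frac1n\sum_{i=1}^n\mathbb I(X_{\pi(i)}=x,Y_i=y,Z_i=z)$, where $\pi$ is the random permutation of the Conditional Permutation scheme applied to $(X_i,Y_i,Z_i)_{i=1}^n$. (i) Let $(k(x,y,z))_{x,y,z}$ be nonnegative integers. If $\sum_x k(x,y,z)=n(y,z)$ for all $(y,z)$ and $\sum_y k(x,y,z)=n(x,z)$ for all $(x,z)$, then $$P\big(n\hat p^*(x,y,z)=k(x,y,z),\ (x,y,z)\in\mathcal X\times\mathcal Y\times\mathcal Z \,\big|\, (X_i,Y_i,Z_i)_{i=1}^n=(x_i,y_i,z_i)_{i=1}^n\big)=\prod_{z\in\mathcal Z}\frac{\prod_{x\in\mathcal X}n(x,z)!\ \prod_{y\in\mathcal Y}n(y,z)!}{n(z)!\ \prod_{(x,y)\in\mathcal X\times\mathcal Y}k(x,y,z)!},$$ where $n(x,z),n(y,z),n(z)$ are the counts of the original sample $(x_i,y_i,z_i)_{i=1}^n$; otherwise this conditional probability equals $0$. (ii) For almost all sequences $(X_i,Y_i,Z_i)_{i=1}^\infty$, conditionally on $(X_i,Y_i,Z_i)_{i=1}^\infty$, as $n\to\infty$, $$\sqrt n\,\big(\hat p^*(x,y,z)-\hat p(x|z)\hat p(y|z)\hat p(z)\big)_{x,y,z}\xrightarrow{d}N(0,\Sigma),$$ where the entry of $\Sigma$ with row index $(x,y,z)$ and column index $(x',y',z')$ is $$\Sigma_{x,y,z}^{x',y',z'}=\mathbb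 I(z=z')\,p(z)\Big(p(x|z)p(y|z)p(x'|z)p(y'|z)-\mathbb I(x=x')p(x|z)p(y|z)p(y'|z)-\mathbb I(y=y')p(x|z)p(x'|z)p(y|z)+\mathbb I(x=x',y=y')p(x|z)p(y|z)\Big).$$
   Context: $(X,Y,Z)$ is a discrete random triple with values in $\mathcal X\times\mathcal Y\times\mathcal Z$ (finite sets), with $p(x,y,z)=P(X=x,Y=y,Z=z)>0$ for all $(x,y,z)$; $p(z)=P(Z=z)$, $p(x|z)=P(X=x|Z=z)$, $p(y|z)=P(Y=y|Z=z)$. $X$ and $Y$ are not assumed conditionally independent given $Z$. $\mathbb I$ denotes the indicator. Counts and empirical probabilities of the original sample of size $n$: $n(x,z)=\sum_{i=1}^n\mathbb I(X_i=x,Z_i=z)$, $n(y,z)=\sum_{i=1}^n\mathbb I(Y_i=y,Z_i=z)$, $n(z)=\sum_{i=1}^n\mathbb I(Z_i=z)$; $\hat p(x|z)=n(x,z)/n(z)$, $\hat p(y|z)=n(y,z)/n(z)$, $\hat p(z)=n(z)/n$ (these are well defined for all large $n$ almost surely). Conditional Permutation (CP) scheme: let $\Pi$ be the set of all permutations $\pi$ of $\{1,\dots,n\}$ preserving each stratum $\{i:Z_i=z\}$, $z\in\mathcal Z$. Conditionally on the data $(X_i,Y_i,Z_i)_{i\ge1}$, $\pi$ is drawn uniformly from $\Pi$, and the CP sample is $(X_{\pi(i)},Y_i,Z_i)_{i=1}^n$. *)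

(* Defs.v *)
From HB Require Import structures.
From mathcomp Require Import all_boot all_order all_algebra all_fingroup.
From mathcomp Require Import all_classical all_reals all_analysis.
Import Order.TTheory GRing.Theory Num.Theory.
Import numFieldNormedType.Exports.

Set Implicit Arguments.
Unset Strict Implicit.
Unset Printing Implicit Defensive.

Local Open Scope classical_set_scope.
Local Open Scope ring_scope.

Section Sample.
Variables (X Y Z : finType) (n : nat).
(* The data (x_i, y_i, z_i), with i ranging over 0, ..., n - 1. *)
Variable D : 'I_n -> X * Y * Z.

Definition obsX (i : 'I_n) : X := (D i).1.1.
Definition obsY (i : 'I_n) : Y := (D i).1.2.
Definition obsZ (i : 'I_n) : Z := (D i).2.

(* In these sums the boolean summand is coerced to 0 or 1. *)
Definition countXZ (x : X) (z : Z) : nat :=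
  (\sum_(i < n) ((obsX i == x) && (obsZ i == z)))%N.
Definition countYZ (y : Y) (z : Z) : nat :=
  (\sum_(i < n) ((obsY i == y) && (obsZ i == z)))%N.
Definition countZ (z : Z) : nat := (\sum_(i < n) (obsZ i == z))%N.

Definition stratum (z : Z) : {set 'I_n} := finset (fun i => obsZ i == z).

Definition cp_perms : {set 'S_n} :=
  finset (fun s : 'S_n =>
    [forall z : Z, [set s i | i in stratum z]%SET == stratum z]).

Definition cp_count (s : 'S_n) (x : X) (y : Y) (z : Z) : nat :=
  (\sum_(i < n) [&& obsX (s i) == x, obsY i == y & obsZ i == z])%N.

Definition margins (k : X -> Y -> Z -> nat) : Prop :=
  (forall y z, (\sum_(x : X) k x y z)%N = countYZ y z) /\
  (forall x z, (\sum_(y : Y) k x y z)%N = countXZ x z).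

Variable R : realType.

(* The conventions 0^-1 = 0 and x / 0 = 0 apply when n(z) = 0 or n = 0. *)
Definition phatX_Z (x : X) (z : Z) : R := (countXZ x z)%:R / (countZ z)%:R.
Definition phatY_Z (y : Y) (z : Z) : R := (countYZ y z)%:R / (countZ z)%:R.
Definition phatZ (z : Z) : R := (countZ z)%:R / n%:R.

Definition phat_star (s : 'S_n) (x : X) (y : Y) (z : Z) : R :=
  n%:R^-1 * (cp_count s x y z)%:R.

Definition cp_uniform (s : 'S_n) : R :=
  if s \in cp_perms then #|cp_perms|%:R^-1 else 0.

(* Families indexed by X * Y * Z are row vectors, through [enum_val]. *)
Definition cp_stat (s : 'S_n) : 'rV[R]_#|{: X * Y * Z}| :=
  \row_j let: (x, y, z) := enum_val j in
    Num.sqrt n%:R * (phat_star s x y z - phatX_Z x z * phatY_Z y z * phatZ z).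

End Sample.

Section Population.
Variables (R : realType) (X Y Z : finType) (p : X -> Y -> Z -> R).

Definition pZ (z : Z) : R := \sum_(x : X) \sum_(y : Y) p x y z.
Definition pX_Z (x : X) (z : Z) : R := (\sum_(y : Y) p x y z) / pZ z.
Definition pY_Z (y : Y) (z : Z) : R := (\sum_(x : X) p x y z) / pZ z.

Definition sigma_entry (x : X) (y : Y) (z : Z) (x' : X) (y' : Y) (z' : Z) : R :=
  (z == z')%:R * pZ z *
  (pX_Z x z * pY_Z y z * pX_Z x' z * pY_Z y' z
   - (x == x')%:R * pX_Z x z * pY_Z y z * pY_Z y' z
   - (y == y')%:R * pX_Z x z * pX_Z x' z * pY_Z y z
   + ((x == x') && (y == y'))%:R * pX_Z x z * pY_Z y z).

Definition Sigma : 'M[R]_#|{: X * Y * Z}| :=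
  \matrix_(i, j) let: (x, y, z) := enum_val i in
                 let: (x', y', z') := enum_val j in
                 sigma_entry x y z x' y' z'.

End Population.

Section Probability.
Context (R : realType) (d : measure_display) (Om : measurableType d).
Variable P : probability Om R.

Definition cond_prob (A B : set Om) : R := fine (P (A `&` B)) / fine (P B).

(* A map into a finite type with its discrete sigma-algebra. *)
Definition finite_rv (T : finType) (V : Om -> T) : Prop :=
  forall t : T, measurable (V @^-1` [set t]).

Definition mutually_independent (T : Type) (W : nat -> Om -> T) : Prop :=
  forall (J : seq nat) (B : nat -> set T), uniq J ->
    P (\bigcap_(i in [set` J]) W i @^-1` B i)
    = (\prod_(i <- J) P (W i @^-1` B i))%E.

Definition iid_copies (X Y Z : finType) (p : X -> Y -> Z -> R)
    (W : nat -> Om -> X * Y * Z) : Prop :=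
  [/\ forall i, finite_rv (W i),
      forall i x y z, P (W i @^-1` [set (x, y, z)]) = (p x y z)%:E
    & mutually_independent W].

(* Generators of sigma(W_0, W_1, ...). *)
Definition seq_events (T : Type) (W : nat -> Om -> T) : set (set Om) :=
  [set A | exists i (B : set T), A = W i @^-1` B].

(* [q w u] is a regular version of P(V = u | sigma(G)) at w. *)
Definition cond_dist (G : set (set Om)) (U : finType) (V : Om -> U)
    (q : Om -> U -> R) : Prop :=
  [/\ forall w u, 0 <= q w u,
      forall w, \sum_(u : U) q w u = 1,
      forall u (B : set R), measurable B -> <<s G >> [set w | B (q w u)]
    & forall u (A : set Om), <<s G >> A ->
        P (A `&` V @^-1` [set u]) = (\int[P]_(w in A) (q w u)%:E)%E].

Definition std_normal_vector (k : nat) (N : Om -> 'rV[R]_k) : Prop :=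
  (forall i : 'I_k, measurable_fun [set: Om] (fun w => N w 0 i)) /\
  (forall B : 'I_k -> set R, (forall i, measurable (B i)) ->
    P [set w | forall i, B i (N w 0 i)]
    = (\prod_(i < k) normal_prob 0 1 (B i))%E).

(* An affine image of a standard normal vector, so that S may be singular. *)
Definition normal_vector (k : nat) (m : 'rV[R]_k) (S : 'M[R]_k)
    (V : Om -> 'rV[R]_k) : Prop :=
  exists (l : nat) (A : 'M[R]_(l, k)) (N : Om -> 'rV[R]_l),
    [/\ std_normal_vector N, A^T *m A = S & forall w, V w = m + N w *m A].

End Probability.

(* Convergence in distribution to N(m, S) of the random vectors V n, defined on
   the finite probability spaces (U n, q n), tested on bounded continuous
   functions. *)
Definition cvg_law_normal (R : realType) (k : nat) (U : nat -> finType)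
    (q : forall n, U n -> R) (V : forall n, U n -> 'rV[R]_k)
    (m : 'rV[R]_k) (S : 'M[R]_k) : Prop :=
  exists (d : measure_display) (Om : measurableType d) (P : probability Om R)
         (L : Om -> 'rV[R]_k),
    normal_vector P m S L /\
    forall f : 'rV[R]_k -> R, continuous f ->
      (exists M : R, forall v, `|f v| <= M) ->
      ((\sum_(u : U n) q n u * f (V n u))%:E @[n --> \oo]
        --> 'E_P[fun w => f (L w)])%E.

Definition sample (T Om : Type) (W : nat -> Om -> T) (n : nat) (w : Om) :
  'I_n -> T := fun i => W i w.
Arguments sample {T Om} W n w.

(* Main.v *)
Require Import Defs.
From HB Require Import structures.
From mathcomp Require Import all_boot all_order all_algebra all_fingroup.
From mathcomp Require Import all_classical all_reals all_analysis.
From mathcomp Require Import measurable_realfun.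
From mathcomp Require Import ring lra.
Import Order.TTheory GRing.Theory Num.Theory.
Import numFieldNormedType.Exports.

Set Implicit Arguments.
Unset Strict Implicit.
Unset Printing Implicit Defensive.

Local Open Scope classical_set_scope.
Local Open Scope ring_scope.

(** Exact law. The admissible permutations form the stabiliser of the map
    i |-> z_i, a product of symmetric groups, of order prod_z n(z)!. Fix one
    admissible s0 whose permuted table is k. The others are the products
    h' s0 h where h' preserves (y, z) and h preserves (x, z), so they form a
    double coset. The product formula for two subgroups gives its size: the
    stabilisers of (x, z) and (y, z) have orders prod n(x,z)! and
    prod n(y,z)!, and the subgroup to divide by is the stabiliser of
    (x o s0, y, z), of order prod k(x,y,z)! ([card_equal_tables],
    [card_cp_table]).

    Central limit theorem. By the law of large numbers ([strong_law]) and the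
    almost sure uniqueness of conditional distributions ([cond_dist_unique]),
    it is enough to treat a fixed sequence of data sets whose frequencies
    converge to those of p ([cp_central_limit]).

    For such a sequence, let S be a linear functional of the normalised table.
    Composing the random permutation with a transposition inside a stratum
    does not change its law, and S is exactly the weighted average, over all
    such transpositions, of the changes that they cause. Stein's method of
    exchangeable pairs then gives, with no approximation,
      E[S g(S)] = (4 sqrt n)^-1 sum_ij w_ij E[D_ij (g(S) - g(S - D_ij / sqrt n))]
    ([stein_identity]). Taking g = id bounds the second moment of S, so that
    the table concentrates around the product of its margins and the vectors
    are tight. Taking g = sin (u . + theta) shows that E cos (u S + theta)
    satisfies, up to O(n^-1/2), the differential equation F' = - u sigma^2 F
    of the Gaussian, where sigma^2 is the limit of the
    conditional variance of the pair. Hence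
    E cos (S + theta) tends to exp (- sigma^2 / 2) cos theta
    ([cvg_cp_char_fun]).

    The Gaussian limit is built by hand: Sigma is a direct sum over z of
    p(z) (diag a - a a^T) tensor (diag b - b b^T), with a = p(.|z) for x and
    b = p(.|z) for y, which has an explicit factor ([cov_rootE]), and a standard
    normal vector comes from a product measure
    ([exists_std_normal_vector]).

    Finally, for tight sequences the convergence of all E cos (t . V + theta)
    extends to every bounded continuous test function
    ([cvg_bounded_continuous]): through the substitution u = sin (x / 2 K),
    Bernstein polynomials become trigonometric polynomials on the whole space,
    which keep the bound of the function and are uniformly close to it on a
    cube ([trig_poly_approx]). *)

(** * Permutations preserving the fibres of a map *)

Section FibreStabiliser.
Variables (I C : finType).
Implicit Types (f g : I -> C) (s : {perm I}).

Definition fibre_stab f : {set {perm I}} := finset (fun s => [forall i, f (s i) == f i]).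

Lemma fibre_stabP f s : reflect (forall i, f (s i) = f i) (s \in fibre_stab f).
Proof. by rewrite inE; apply: (iffP forallP) => h i; apply/eqP. Qed.

Lemma fibre_stab_group_set f : group_set (fibre_stab f).
Proof.
apply/group_setP; split=> [|s t /fibre_stabP hs /fibre_stabP ht];
  apply/fibre_stabP => i; first by rewrite perm1.
by rewrite permM ht hs.
Qed.
Canonical fibre_stab_group f := Group (fibre_stab_group_set f).

Definition fibre f c : {set I} := finset (fun i => f i == c).

Lemma in_fibre f c i : (i \in fibre f c) = (f i == c).
Proof. by rewrite inE. Qed.

(** A fibre-preserving permutation is the same thing as a family of
    permutations, one supported on each fibre; [gl] glues such a family. *)
Lemma card_fibre_stab f : #|fibre_stab f| = (\prod_(c : C) (#|fibre f c|)`!)%N.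
Proof.
pose pieces := family (fun c : C => [pred s : {perm I} | perm_on (fibre f c) s]).
pose glue (F : {ffun C -> {perm I}}) : {ffun I -> I} := [ffun i => F (f i) i].
have fibF F c i : F \in pieces -> f (F c i) = f i.
  move=> /familyP/(_ c) /= Fc; case: (f i =P c) => [fic|nfic].
    by have := perm_closed i Fc; rewrite !inE fic eqxx => /eqP ->.
  by rewrite (out_perm Fc) // inE; apply/eqP.
pose gl F : {perm I} := odflt 1%g [pick s : {perm I} | [forall i, s i == glue F i]].
have glE F i : F \in pieces -> gl F i = F (f i) i.
  move=> Fp; have glI : injective (glue F).
    move=> j k; rewrite !ffunE => e.
    have := congr1 f e; rewrite !fibF // => fjk.
    by move: e; rewrite fjk; apply: perm_inj.
  rewrite /gl; case: pickP => [s /forallP/(_ i)/eqP -> /=|/(_ (perm glI))].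
    by rewrite ffunE.
  by case/forallP => j; rewrite permE.
transitivity #|gl @: pieces|.
  apply/esym/eq_card => s; apply/imsetP/fibre_stabP.
    by move=> [F Fp ->] i; rewrite glE // fibF.
  move=> sf; exists [ffun c => restr_perm (fibre f c) s].
    apply/familyP => c; rewrite ffunE inE /=; exact: restr_perm_on.
  apply/permP => i; rewrite glE; last first.
    apply/familyP => c; rewrite ffunE inE /=; exact: restr_perm_on.
  rewrite ffunE restr_permE //; last by rewrite inE.
  rewrite 2!inE; apply/andP; split; first by rewrite inE.
  apply/fintype.subsetP => j; rewrite !inE /= => /eqP fj.
  by rewrite /aperm sf fj.
rewrite card_in_imset; last first.
  move=> F G Fp Gp e; apply/ffunP => c; apply/permP => i.
  have [fic|nfic] := eqVneq (f i) c; first by rewrite -fic -!glE // e.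
  move: Fp Gp => /familyP/(_ c) Fc /familyP/(_ c) Gc.
  have nic : i \notin fibre f c by rewrite in_fibre.
  by rewrite (@out_perm _ (fibre f c) (F c)) ?(@out_perm _ (fibre f c) (G c)).
rewrite card_family /image_mem foldrE big_map -big_enum /=.
apply: eq_bigr => c _; rewrite -card_perm.
exact: eq_card.
Qed.

End FibreStabiliser.

Lemma count_fibre (n : nat) (C : finType) (h : 'I_n -> C) c :
  count_mem c [seq h i | i <- enum 'I_n] = #|fibre h c|.
Proof.
rewrite -sum1_count -sum1_card big_map big_enum_cond /=.
by apply: eq_bigl => i; rewrite in_fibre.
Qed.

(** Two enumerations with the same multiplicities differ by a permutation of
    the positions. *)
Lemma fibre_perm (n : nat) (C : finType) (f g : 'I_n -> C) :
  (forall c, #|fibre f c| = #|fibre g c|) ->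
  exists s : 'S_n, forall i, f (s i) = g i.
Proof.
move=> fg.
have fibE (h : 'I_n -> C) c : count_mem c [tuple h i | i < n] = #|fibre h c|.
  by rewrite count_fibre.
have /tuple_permP [s sE] : perm_eq [tuple g i | i < n] [tuple f i | i < n].
  by apply/allP => c _ /=; rewrite !fibE fg.
exists s => i; have /(congr1 (fun t : n.-tuple C => tnth t i)) := val_inj sE.
by rewrite !tnth_mktuple.
Qed.

(** The list [s] holds each pair [(a, c)] exactly [k a c] times; its second
    components are a permutation of the values of [h], so reading its first
    components through that permutation gives the labelling. *)
Lemma exists_labelling (n : nat) (A C : finType) (h : 'I_n -> C) (k : A -> C -> nat) :
  (forall c, (\sum_(a : A) k a c)%N = #|fibre h c|) ->
  exists l : 'I_n -> A, forall a c, #|fibre (fun i => (l i, h i)) (a, c)| = k a c.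
Proof.
move=> kh.
pose s := flatten [seq nseq (k v.1 v.2) v | v <- enum {: A * C}].
have cs v : count_mem v s = k v.1 v.2.
  rewrite count_flatten -map_comp sumnE big_map big_enum /= (bigD1 v) //=.
  rewrite count_nseq /= eqxx mul1n big1 ?addn0 // => u uv.
  by rewrite count_nseq /= (negbTE uv).
have csnd c : count_mem c (map snd s) = #|fibre h c|.
  rewrite count_map -kh count_flatten -map_comp sumnE big_map big_enum /=.
  transitivity (\sum_(v : A * C) (v.2 == c) * k v.1 v.2)%N.
    by apply: eq_bigr => v _; rewrite /= count_nseq.
  rewrite -(pair_bigA _ (fun a c' => (c' == c) * k a c')%N) /=.
  apply: eq_bigr => a _; rewrite (bigD1 c) //= eqxx mul1n.
  by rewrite big1 ?addn0 // => c' /negbTE ->.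
have fibE c : count_mem c [tuple h i | i < n] = #|fibre h c|.
  by rewrite count_fibre.
have pe : perm_eq (map snd s) [tuple h i | i < n].
  by apply/allP => c _ /=; rewrite fibE csnd.
have ss : size s == n by rewrite -(size_map snd) (perm_size pe) size_tuple.
pose t := Tuple ss.
have /tuple_permP [p pE] : perm_eq [tuple h i | i < n] [tuple (tnth t i).2 | i < n].
  rewrite perm_sym [X in perm_eq X _](_ : _ = map snd s) //.
  by rewrite /= (map_comp snd) map_tnth_enum.
have hE i : h i = (tnth t (p i)).2.
  by have := congr1 (fun t : n.-tuple C => tnth t i) (val_inj pE); rewrite !tnth_mktuple.
exists (fun i => (tnth t (p i)).1) => a c.
have sE : s = [seq tnth t i | i <- enum 'I_n] by rewrite map_tnth_enum.
rewrite -(cs (a, c)) sE count_fibre.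
rewrite -(card_imset _ (@perm_inj _ p)); apply: eq_card => i.
apply/imsetP/idP => [[j + ->]|].
  by rewrite !inE hE -surjective_pairing.
rewrite inE => ti; exists (p^-1 i)%g; last by rewrite permKV.
by rewrite inE hE permKV -surjective_pairing.
Qed.

Lemma card_fibre_perm (I C : finType) (f : I -> C) (s : {perm I}) c :
  #|fibre (fun i => f (s i)) c| = #|fibre f c|.
Proof.
rewrite -(card_preimset (fibre f c) (@perm_inj _ s)).
by apply: eq_card => i; rewrite !inE.
Qed.

(** The permutations [s] for which [(f o s, g)] has the same joint table as
    [(f o s0, g)] form the double coset [H s0 F], where [H] and [F] are the
    stabilisers of [g] and [f]. Translating by [s0] on the right turns it into
    the product of [H] with a conjugate [K] of [F], and [H] meets [K] in the
    stabiliser of [(f o s0, g)]. *)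
Lemma card_equal_tables (n : nat) (A B : finType) (f : 'I_n -> A) (g : 'I_n -> B)
    (s0 : 'S_n) :
  (#|finset (fun s : 'S_n => [forall v,
        #|fibre (fun i => (f (s i), g i)) v| == #|fibre (fun i => (f (s0 i), g i)) v|])|
    * \prod_v (#|fibre (fun i => (f (s0 i), g i)) v|)`!)%N
  = ((\prod_a (#|fibre f a|)`!) * \prod_b (#|fibre g b|)`!)%N.
Proof.
set T := finset _; pose K := (fibre_stab_group f :^ s0^-1)%G.
have inK s : (s \in K) = [forall i, f (s0 (s i)) == f (s0 i)].
  rewrite mem_conjg invgK; apply/idP/idP => [/fibre_stabP h|/forallP h].
    by apply/forallP => i; have := h (s0 i); rewrite conjgE !permM permK => ->.
  by apply/fibre_stabP => i; rewrite conjgE !permM (eqP (h _)) permKV.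
have TE : T = ((fibre_stab g * K) :* s0)%g.
  apply/setP => s; rewrite mem_rcoset inE; apply/forallP/mulsgP.
    move=> h; have [t tE] : exists t : 'S_n, forall i,
        (fun i => (f (s0 i), g i)) (t i) = (fun i => (f (s i), g i)) i.
      apply: (fibre_perm (f := fun i => (f (s0 i), g i)) (g := fun i => (f (s i), g i))).
      by move=> v; rewrite (eqP (h v)).
    exists t (t^-1 * s * s0^-1)%g; last by rewrite !mulgA mulgV mul1g.
      by apply/fibre_stabP => i; case: (tE i).
    rewrite inK; apply/forallP => i; rewrite !permM permKV.
    by have [<- _] := tE ((t^-1)%g i); rewrite permKV.
  move=> [t u /fibre_stabP tg uK sE] v.
  have {}sE : s = (t * u * s0)%g by rewrite -sE mulgKV.
  move: uK; rewrite inK => /forallP uK.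
  rewrite -(card_fibre_perm (fun i => (f (s0 i), g i)) t); apply/eqP.
  apply: eq_card => i; rewrite !inE sE !permM (eqP (uK _)).
  by rewrite tg.
have IE : (fibre_stab g :&: K)%g = fibre_stab (fun i => (f (s0 i), g i)).
  apply/setP => s; rewrite finset.in_setI inK; apply/andP/fibre_stabP.
    by move=> [/fibre_stabP h /forallP h'] i; rewrite h (eqP (h' i)).
  by move=> h; split; [apply/fibre_stabP|apply/forallP] => i; case: (h i) => // ->.
rewrite -!card_fibre_stab TE card_rcoset -IE -mul_cardG cardJg mulnC //.
Qed.

(** * Contingency tables of the permuted sample *)

Section Tables.
Variables (X Y Z : finType) (n : nat) (D : 'I_n -> X * Y * Z).

Lemma sum_bool_card (b : 'I_n -> bool) : (\sum_(i < n) b i)%N = #|finset b|.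
Proof.
by rewrite -sum1_card [RHS]big_mkcond /=; apply: eq_bigr => i _; rewrite inE; case: (b i).
Qed.

Definition keyXZ i := (obsX D i, obsZ D i).
Definition keyYZ i := (obsY D i, obsZ D i).

Lemma countXZE x z : countXZ D x z = #|fibre keyXZ (x, z)|.
Proof. by rewrite /countXZ sum_bool_card; apply: eq_card => i; rewrite !inE. Qed.

Lemma countYZE y z : countYZ D y z = #|fibre keyYZ (y, z)|.
Proof. by rewrite /countYZ sum_bool_card; apply: eq_card => i; rewrite !inE. Qed.

Lemma countZE z : countZ D z = #|fibre (obsZ D) z|.
Proof. by rewrite /countZ sum_bool_card; apply: eq_card => i; rewrite !inE. Qed.

Lemma cp_permsE : cp_perms D = fibre_stab (obsZ D).
Proof.
apply/setP => s; rewrite !inE; apply/forallP/forallP => h.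
  move=> i; have /eqP hz := h (obsZ D i).
  have : s i \in stratum D (obsZ D i) by rewrite -hz imset_f // inE.
  by rewrite inE.
move=> z; rewrite eqEcard card_imset ?leqnn ?andbT; last exact: perm_inj.
apply/fintype.subsetP => _ /imsetP[i + ->]; rewrite !inE => /eqP <-.
exact: h.
Qed.

Lemma card_cp_perms : #|cp_perms D| = (\prod_z (countZ D z)`!)%N.
Proof.
rewrite cp_permsE card_fibre_stab; by apply: eq_bigr => z _; rewrite countZE.
Qed.

Lemma cp_countE s x y z : s \in cp_perms D ->
  cp_count D s x y z = #|fibre (fun i => (keyXZ (s i), keyYZ i)) ((x, z), (y, z))|.
Proof.
rewrite cp_permsE => /fibre_stabP sZ.
rewrite /cp_count sum_bool_card; apply: eq_card => i; rewrite !inE !xpair_eqE sZ.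
by case: (_ == x); case: (_ == y); case: (_ == z).
Qed.

Lemma cp_count_margins s : s \in cp_perms D -> margins D (cp_count D s).
Proof.
rewrite cp_permsE => /fibre_stabP sZ; split=> [y z|x z]; rewrite exchange_big /=.
  apply: eq_bigr => i _; rewrite (bigD1 (obsX D (s i))) //= eqxx /=.
  by rewrite big1 ?addn0 // => x; rewrite eq_sym => /negbTE ->.
rewrite /countXZ [RHS](reindex_inj (@perm_inj _ s)) /=.
apply: eq_bigr => i _; rewrite (bigD1 (obsY D i)) //= eqxx /= sZ.
by rewrite big1 ?addn0 // => y; rewrite eq_sym => /negbTE ->; rewrite andbF.
Qed.

Definition cp_table (k : X -> Y -> Z -> nat) : {set 'S_n} :=
  finset (fun s => (s \in cp_perms D) &&
    [forall x, forall y, forall z, cp_count D s x y z == k x y z]).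

Lemma cp_tableP k s : reflect (s \in cp_perms D /\ forall x y z, cp_count D s x y z = k x y z)
   (s \in cp_table k).
Proof.
rewrite [X in reflect _ X]inE; apply: (iffP andP) => [[sP h]|[sP h]]; split=> //.
  by move=> x y z; apply/eqP; move: h => /forallP/(_ x)/forallP/(_ y)/forallP/(_ z).
by apply/forallP => x; apply/forallP => y; apply/forallP => z; apply/eqP.
Qed.

(** A labelling [l] with joint table [k] against [(y, z)] has the same
    [(x, z)] counts as the data, hence is a rearrangement of it. *)
Lemma cp_table_neq0 k : margins D k -> exists s, s \in cp_table k.
Proof.
move=> [mY mX].
have [l lE] : exists l : 'I_n -> X, forall x c,
    #|fibre (fun i => (l i, keyYZ i)) (x, c)| = k x c.1 c.2.
  by apply: (exists_labelling (k := fun x c => k x c.1 c.2)) => -[y z]; rewrite mY countYZE.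
have [s sE] : exists s : 'S_n, forall i, keyXZ (s i) = (l i, obsZ D i).
  apply: (fibre_perm (f := keyXZ) (g := fun i => (l i, obsZ D i))) => -[x z].
  rewrite -countXZE -mX.
  transitivity (\sum_y #|fibre (fun i => (l i, keyYZ i)) (x, (y, z))|)%N.
    by apply: eq_bigr => y _; rewrite lE.
  under eq_bigr do rewrite -sum_bool_card.
  rewrite exchange_big -sum_bool_card /=; apply: eq_bigr => i _.
  rewrite (bigD1 (obsY D i)) //= !xpair_eqE eqxx /=.
  rewrite big1 ?addn0 // => y; rewrite eq_sym !xpair_eqE => /negbTE ->.
  by rewrite andbF.
have sP : s \in cp_perms D.
  by rewrite cp_permsE; apply/fibre_stabP => i; case: (sE i).
exists s; apply/cp_tableP; split=> // x y z.
rewrite cp_countE // -(lE x (y, z)); apply: eq_card => i; rewrite !inE sE !xpair_eqE /=.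
by case: (_ == x); case: (_ == y); case: (_ == z).
Qed.

(** [card_equal_tables] for the pairs [(x, z)] and [(y, z)]: the cells
    [((x, z), (y, z'))] with [z != z'] are all empty exactly when the
    permutation is admissible, and then they contribute factors [0! = 1]. *)
Lemma card_cp_table k : margins D k ->
  (#|cp_table k| * \prod_z \prod_(xy : X * Y) (k xy.1 xy.2 z)`!)%N
  = (\prod_z ((\prod_x (countXZ D x z)`!) * \prod_y (countYZ D y z)`!))%N.
Proof.
move=> mk; have [s0 /cp_tableP[s0P s0k]] := cp_table_neq0 mk.
have s0E (a : (X * Z) * (Y * Z)) : #|fibre (fun i => (keyXZ (s0 i), keyYZ i)) a|
    = if a.1.2 == a.2.2 then k a.1.1 a.2.1 a.1.2 else 0%N.
  case: a => [[x z] [y z']] /=; case: eqP => [<-|zz]; first by rewrite -cp_countE.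
  apply/eqP; rewrite cards_eq0; apply/set0Pn => -[i]; rewrite inE !xpair_eqE /=.
  move: s0P; rewrite cp_permsE => /fibre_stabP ->.
  by case/andP => /andP[_ /eqP ->] /andP[_ /eqP].
transitivity ((\prod_a (#|fibre keyXZ a|)`!) * \prod_b (#|fibre keyYZ b|)`!)%N; last first.
  rewrite big_split /=; congr (_ * _)%N.
    rewrite exchange_big pair_bigA; apply: eq_bigr => -[x z] _; by rewrite countXZE.
  by rewrite exchange_big pair_bigA; apply: eq_bigr => -[x z] _; rewrite countYZE.
rewrite -(card_equal_tables keyXZ keyYZ s0); congr (_ * _)%N.
  apply: eq_card => s; rewrite [in RHS]inE; apply/cp_tableP/forallP.
    move=> [sP sk] [[x z] [y z']]; rewrite s0E /=; case: (z =P z') => [<-|zz].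
      by rewrite -cp_countE // sk.
    rewrite cards_eq0; apply/set0Pn => -[i]; rewrite inE !xpair_eqE /=.
    move: sP; rewrite cp_permsE => /fibre_stabP ->.
    by case/andP => /andP[_ /eqP ->] /andP[_ /eqP].
  move=> h; have sP : s \in cp_perms D.
    rewrite cp_permsE; apply/fibre_stabP => i; apply/eqP.
    have := h (keyXZ (s i), keyYZ i); rewrite s0E /=.
    case: (obsZ D (s i) =P obsZ D i) => // _.
    rewrite cards_eq0 => /eqP/setP/(_ i); by rewrite !inE eqxx.
  split=> // x y z; rewrite cp_countE // (eqP (h _)) s0E /= eqxx //.
under [RHS]eq_bigr do rewrite s0E.
rewrite -(pair_bigA _ (fun a b => (if a.2 == b.2 then k a.1 b.1 a.2 else 0)`!)%N) /=.
rewrite -(pair_bigA _ (fun x z => \prod_(b : Y * Z) (if z == b.2 then k x b.1 z else 0)`!)%N) /=.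
rewrite [RHS]exchange_big /=; apply: eq_bigr => z _.
rewrite -(pair_bigA _ (fun x y => (k x y z)`!)) /=; apply: eq_bigr => x _.
rewrite -(pair_bigA _ (fun y z' => (if z == z' then k x y z else 0)`!)%N) /=.
apply: eq_bigr => y _; rewrite (bigD1 z) //= eqxx big1 ?muln1 // => z'.
by rewrite eq_sym => /negbTE ->.
Qed.

End Tables.

(** * Calculus on the real line *)

Section Calculus.
Variable R : realType.
Implicit Types (a b x y : R) (f df : R -> R).

Lemma continuous_of_derive f df : (forall z : R, is_derive z 1 f (df z)) -> continuous f.
Proof.
move=> fdf z; apply: differentiable_continuous.
by apply/derivable1_diffP; have := fdf z; move/@ex_derive.
Qed.

Lemma mean_value f df x y : (forall z : R, is_derive z 1 f (df z)) ->
  exists2 z, `|z - x| <= `|y - x| & f y - f x = df z * (y - x).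
Proof.
move=> fdf.
have cf u v : {within `[u, v], continuous f}.
  by apply: continuous_subspaceT; exact: continuous_of_derive fdf.
have [xy|yx] := leP x y.
  have [z zxy fE] := MVT_segment xy (fun z _ => fdf z) (@cf _ _).
  exists z => //; move: zxy; rewrite in_itv /= => /andP[xz zy].
  by rewrite !ger0_norm ?subr_ge0 // lerB.
have [z zxy fE] := MVT_segment (ltW yx) (fun z _ => fdf z) (@cf _ _).
exists z; last by rewrite -opprB fE -mulrN opprB.
move: zxy; rewrite in_itv /= => /andP[xz zy].
by rewrite !ler0_norm ?subr_le0 ?(ltW yx) // lerN2 lerB.
Qed.

Lemma lipschitz1 f df : (forall z : R, is_derive z 1 f (df z)) -> (forall z, `|df z| <= 1) ->
  forall x y, `|f y - f x| <= `|y - x|.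
Proof.
move=> fdf df1 x y; have [z _ ->] := mean_value x y fdf.
by rewrite normrM ler_piMl.
Qed.

Lemma cos_lip x y : `|cos y - cos x| <= `|y - x|.
Proof.
by apply: (@lipschitz1 _ (fun z => - sin z)) => z; rewrite ?normrN sin_max.
Qed.

(** By the mean value theorem the left-hand side is [b (cos z - cos a)] with
    [|z - a| <= |b|]. *)
Lemma sin_taylor a b : `|sin a - sin (a - b) - b * cos a| <= b ^+ 2.
Proof.
have [z za zE] := mean_value a (a - b) (@is_derive_sin R).
have -> : sin a - sin (a - b) - b * cos a = b * (cos z - cos a).
  by rewrite -(opprB (sin (a - b))) zE; ring.
rewrite normrM -real_normK ?num_real // expr2 ler_wpM2l //.
apply: le_trans (cos_lip a z) (le_trans za _).
by rewrite addrAC subrr add0r normrN.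
Qed.
End Calculus.

Section DerivativeRules.
Variable R : realType.

Lemma is_derive_fsum (I : finType) (h : I -> R -> R) (dh : I -> R) (u : R) :
  (forall i, is_derive u (1 : R) (h i) (dh i)) ->
  is_derive u (1 : R) (fun x => \sum_i h i x) (\sum_i dh i).
Proof.
move=> hd; rewrite (_ : (fun x => _) = \sum_i h i); last first.
  by apply/funext => x; rewrite fct_sumE.
by elim/big_ind2 : _ => // [|] *; [exact: is_derive_cst|exact: is_deriveD].
Qed.

Lemma is_derive_cos_affine (a b u : R) :
  is_derive u (1 : R) (fun x => cos (x * a + b)) (- (a * sin (u * a + b))).
Proof.
have h : is_derive u (1 : R) (fun x : R => x * a + b) a.
  by apply: is_derive_eq; rewrite addr0 scaler0 add0r /GRing.scale /= mulr1.
have := @is_derive1_comp _ cos (fun x : R => x * a + b) u _ _ _ h.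
by move=> /(_ _ (is_derive_cos _)) /is_derive_eq; apply; rewrite mulNr mulrC.
Qed.

Lemma is_derive_expR_sqr (a u : R) :
  is_derive u (1 : R) (fun x => expR (a * x ^+ 2 / 2)) (a * u * expR (a * u ^+ 2 / 2)).
Proof.
have h : is_derive u (1 : R) (fun x : R => a * x ^+ 2 / 2) (a * u).
  apply: is_derive_eq; rewrite ?scaler0 ?add0r ?addr0 /GRing.scale /=; by field.
have := @is_derive1_comp _ expR (fun x : R => a * x ^+ 2 / 2) u _ _ _ h.
by move=> /(_ _ (is_derive_expR _)) /is_derive_eq; apply; rewrite mulrC.
Qed.
End DerivativeRules.

Lemma cvg_fsum (R : realType) (I : finType) (f : I -> nat -> R) (a : I -> R) :
  (forall i, f i n @[n --> \oo] --> a i) -> \sum_i f i n @[n --> \oo] --> \sum_i a i.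
Proof. by move=> fa; apply: cvg_big => //; exact: add_continuous. Qed.

Lemma cvg_invsqrt (R : realType) : (Num.sqrt (n%:R : R))^-1 @[n --> \oo] --> (0 : R).
Proof.
have h : (n%:R : R)^-1 @[n --> \oo] --> (0 : R) by rewrite -cvg_shiftS; exact: cvg_harmonic.
rewrite [X in _ --> X](_ : 0 = Num.sqrt 0); last by rewrite sqrtr0.
rewrite (_ : (fun n => _) = Num.sqrt \o (fun n => n%:R^-1)); last first.
  by apply/funext => n /=; rewrite sqrtrV.
by apply: cvg_comp h _; exact: sqrt_continuous.
Qed.

Lemma cvg_of_dist (R : realType) (f b : nat -> R) (l : R) :
  (forall n, (0 < n)%N -> `|f n - l| <= b n) -> b n @[n --> \oo] --> (0 : R) ->
  f n @[n --> \oo] --> l.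
Proof.
move=> fb b0; apply/cvgrPdist_le => e e0.
move/cvgrPdist_le : b0 => /(_ _ e0) b0; near=> n.
rewrite distrC; apply: le_trans (fb n _) _; first by near: n; exists 1%N.
have : `|0 - b n| <= e by near: n.
by rewrite sub0r normrN; apply: le_trans; exact: ler_norm.
Unshelve. all: by end_near. Qed.

(** * The exchangeable pair of a random transposition *)

Section SwapIdentity.
Variables (R : realType) (X Y Z : finType) (n : nat) (D : 'I_n -> X * Y * Z).
Hypothesis n_gt0 : (0 < n)%N.
Let rn : R := Num.sqrt n%:R.
Let rn_gt0 : 0 < rn. Proof. by rewrite sqrtr_gt0 ltr0n. Qed.
Let rnK : rn ^+ 2 = n%:R. Proof. by rewrite sqr_sqrtr. Qed.
Local Notation q := (cp_uniform D R).

Definition cp_mean (h : 'S_n -> R) : R := \sum_s q s * h s.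

Lemma cp_uniform_ge0 s : 0 <= q s.
Proof. by rewrite /cp_uniform; case: ifP => // _; rewrite invr_ge0. Qed.

Lemma cp_perms1 : 1%g \in cp_perms D.
Proof. by rewrite cp_permsE group1. Qed.

Lemma cp_mean_cst (c : R) : cp_mean (fun=> c) = c.
Proof.
rewrite /cp_mean -mulr_suml -[RHS]mul1r; congr (_ * _).
rewrite /cp_uniform -big_mkcond /= sumr_const -[LHS]mulr_natl divff //.
by rewrite pnatr_eq0 -lt0n; apply/card_gt0P; exists 1%g; exact: cp_perms1.
Qed.

Lemma cp_meanD h1 h2 : cp_mean (fun s => h1 s + h2 s) = cp_mean h1 + cp_mean h2.
Proof. by rewrite -big_split; apply: eq_bigr => s _; rewrite mulrDr. Qed.

Lemma cp_meanZ c h : cp_mean (fun s => c * h s) = c * cp_mean h.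
Proof. by rewrite big_distrr; apply: eq_bigr => s _; rewrite mulrCA. Qed.

Lemma cp_mean_sum (J : finType) (h : J -> 'S_n -> R) :
  cp_mean (fun s => \sum_j h j s) = \sum_j cp_mean (h j).
Proof. by rewrite exchange_big; apply: eq_bigr => s _; rewrite big_distrr. Qed.

Lemma eq_cp_mean h1 h2 : {in cp_perms D, h1 =1 h2} -> cp_mean h1 = cp_mean h2.
Proof.
move=> h12; apply: eq_bigr => s _; rewrite /cp_uniform.
by case: ifP => [/h12 ->|]; rewrite ?mul0r.
Qed.

Lemma ler_cp_mean h1 h2 : (forall s, s \in cp_perms D -> h1 s <= h2 s) -> cp_mean h1 <= cp_mean h2.
Proof.
move=> h12; apply: ler_sum => s _; have := cp_uniform_ge0 s; rewrite /cp_uniform.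
by case: ifP => [/h12 h q0|]; rewrite ?mul0r // ler_wpM2l.
Qed.

Lemma cp_mean_norm h : `|cp_mean h| <= cp_mean (fun s => `|h s|).
Proof.
apply: le_trans (ler_norm_sum _ _ _) _; apply: ler_sum => s _.
by rewrite normrM ger0_norm ?cp_uniform_ge0.
Qed.

(** The admissible permutations form a group containing the transpositions
    inside a stratum. *)
Lemma cp_mean_swap i j h : obsZ D i = obsZ D j ->
  cp_mean (fun s => h (tperm i j * s)%g) = cp_mean h.
Proof.
move=> ij; rewrite /cp_mean [RHS](reindex_inj (mulgI (tperm i j))) /=.
have tP : tperm i j \in fibre_stab_group (obsZ D).
  by apply/fibre_stabP => k; case: tpermP => // ->.
by apply: eq_bigr => s _; rewrite /cp_uniform cp_permsE (groupMl _ tP).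
Qed.

Section Statistic.
Variable t : X * Y * Z -> R.
Implicit Types (s : 'S_n) (i j : 'I_n).

(** The linear functional [t] of the normalised table, the variable S of the
    characteristic function argument. *)
Definition cp_lin s : R := \sum_(v : X * Y * Z)
  t v * (rn * (phat_star D R s v.1.1 v.1.2 v.2
               - phatX_Z D R v.1.1 v.2 * phatY_Z D R v.1.2 v.2 * phatZ D R v.2)).

(** Swapping the images of [i] and [j] lowers the total score
    [\sum_i score i (s i)] by [swap_diff s i j]; the weights [swap_weight]
    select the pairs inside a stratum and average over one member. *)
Definition score i j : R := t (obsX D j, obsY D i, obsZ D i).
Definition swap_weight i j : R := (obsZ D i == obsZ D j)%:R / (countZ D (obsZ D i))%:R.
Definition swap_diff s i j : R :=
  score i (s i) + score j (s j) - score i (s j) - score j (s i).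

Lemma countZ_gt0 i : (0 < countZ D (obsZ D i))%N.
Proof. by rewrite countZE; apply/card_gt0P; exists i; rewrite inE. Qed.

Lemma swap_weight_ge0 i j : 0 <= swap_weight i j.
Proof. by rewrite mulr_ge0 ?invr_ge0. Qed.

Lemma swap_weightC i j : swap_weight i j = swap_weight j i.
Proof. by rewrite /swap_weight eq_sym; case: eqP => [->|] //; rewrite !mul0r. Qed.

Lemma sum_swap_weight i : \sum_j swap_weight i j = 1.
Proof.
rewrite -mulr_suml -natr_sum.
have -> : (\sum_j (obsZ D i == obsZ D j))%N = countZ D (obsZ D i).
  by apply: eq_bigr => j _; rewrite eq_sym.
by rewrite divff // pnatr_eq0 -lt0n countZ_gt0.
Qed.

Lemma sum_key (V : finType) (key : 'I_n -> V) (F : V -> R) :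
  \sum_i F (key i) = \sum_v (\sum_i (key i == v))%N%:R * F v.
Proof.
under [RHS]eq_bigr do rewrite natr_sum mulr_suml.
rewrite exchange_big; apply: eq_bigr => i _.
rewrite (bigD1 (key i)) //= eqxx mul1r big1 ?addr0 // => v.
by rewrite eq_sym => /negbTE ->; rewrite mul0r.
Qed.

Definition permuted_obs s i := (obsX D (s i), obsY D i, obsZ D i).

Lemma cp_count_permuted_obs s v : cp_count D s v.1.1 v.1.2 v.2 = (\sum_i (permuted_obs s i == v))%N.
Proof.
by case: v => [[x y] z]; apply: eq_bigr => i _; rewrite /permuted_obs !xpair_eqE andbA.
Qed.

Lemma sum_score s : \sum_i score i (s i) = \sum_v (cp_count D s v.1.1 v.1.2 v.2)%:R * t v.
Proof.
rewrite (sum_key (permuted_obs s)); apply: eq_bigr => v _.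
by rewrite cp_count_permuted_obs.
Qed.

Lemma sum_swap_weight_score : \sum_i \sum_j swap_weight i j * score i j =
  \sum_v t v * ((countXZ D v.1.1 v.2)%:R * (countYZ D v.1.2 v.2)%:R / (countZ D v.2)%:R).
Proof.
transitivity (\sum_v \sum_i \sum_j
   ((obsX D j == v.1.1) && (obsZ D j == v.2))%:R * ((obsY D i == v.1.2) && (obsZ D i == v.2))%:R
   / (countZ D v.2)%:R * t v); last first.
  apply: eq_bigr => v _; rewrite [RHS]mulrC.
  under eq_bigr do rewrite -!mulr_suml.
  by rewrite -!mulr_suml -mulr_sumr -!natr_sum.
rewrite [RHS]exchange_big /=; apply: eq_bigr => i _.
rewrite [RHS]exchange_big /=; apply: eq_bigr => j _.
pose v0 := (obsX D j, obsY D i, obsZ D i).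
rewrite (bigD1 v0) //= big1 ?addr0 => [|[[x y] z] /=]; last first.
  rewrite /v0 !xpair_eqE !(eq_sym _ x, eq_sym _ y, eq_sym _ z) => h.
  case: (x =P _) h => [_|]; last by rewrite !mul0r.
  case: (y =P _) => [_|]; last by rewrite !(mulr0,mul0r).
  by move=> /= /negbTE ->; rewrite !(mulr0,mul0r).
by rewrite !eqxx /= mulr1 /swap_weight eq_sym.
Qed.

Lemma cp_linE s : cp_lin s =
  rn^-1 * (\sum_i score i (s i) - \sum_i \sum_j swap_weight i j * score i j).
Proof.
rewrite sum_score sum_swap_weight_score -sumrB big_distrr; apply: eq_bigr => v _ /=.
have rn0 : rn != 0 by rewrite gt_eqF.
have nE : n%:R = rn ^+ 2 by rewrite rnK.
rewrite /phat_star /phatX_Z /phatY_Z /phatZ nE.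
have [z0|z0] := eqVneq ((countZ D v.2)%:R : R) 0; first by rewrite z0 invr0; field.
by field; rewrite z0 rn0.
Qed.

Lemma sum_swap_weight_perm s i : s \in cp_perms D ->
  \sum_j swap_weight i j * score i (s j) = \sum_j swap_weight i j * score i j.
Proof.
rewrite cp_permsE => /fibre_stabP sZ.
rewrite [RHS](reindex_inj (@perm_inj _ s)); apply: eq_bigr => j _.
by rewrite /swap_weight sZ.
Qed.

(** The terms [score i (s i)] of [swap_diff] add up to the total score, and
    the cross terms [score i (s j)] to its mean, which does not depend on
    [s]: the statistic is an exact average of its own swap differences. *)
Lemma cp_lin_swap_diff s : s \in cp_perms D ->
  cp_lin s = (2 * rn)^-1 * \sum_i \sum_j swap_weight i j * swap_diff s i j.
Proof.
move=> sP; rewrite cp_linE.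
pose A := \sum_i score i (s i); pose B := \sum_i \sum_j swap_weight i j * score i j.
have A1 : \sum_i \sum_j swap_weight i j * score i (s i) = A.
  by apply: eq_bigr => i _; rewrite -mulr_suml sum_swap_weight mul1r.
have A2 : \sum_i \sum_j swap_weight i j * score j (s j) = A.
  rewrite exchange_big -A1; apply: eq_bigr => i _; apply: eq_bigr => j _.
  by rewrite swap_weightC.
have B1 : \sum_i \sum_j swap_weight i j * score i (s j) = B.
  by apply: eq_bigr => i _; exact: sum_swap_weight_perm.
have B2 : \sum_i \sum_j swap_weight i j * score j (s i) = B.
  rewrite exchange_big -B1; apply: eq_bigr => i _; apply: eq_bigr => j _.
  by rewrite swap_weightC.
have -> : \sum_i \sum_j swap_weight i j * swap_diff s i j = 2 * (A - B).
  transitivity (A + A - B - B); last by ring.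
  rewrite -{1}A1 -A2 -{1}B1 -B2 -big_split -!sumrB; apply: eq_bigr => i _ /=.
  rewrite -big_split -!sumrB; apply: eq_bigr => j _ /=.
  by rewrite /swap_diff; ring.
by rewrite -/A -/B; field; rewrite gt_eqF.
Qed.

Lemma swap_diff_tperm s i j : swap_diff (tperm i j * s)%g i j = - swap_diff s i j.
Proof. by rewrite /swap_diff !permM tpermL tpermR; ring. Qed.

Lemma cp_lin_tperm s i j : cp_lin (tperm i j * s)%g = cp_lin s - rn^-1 * swap_diff s i j.
Proof.
rewrite !cp_linE -mulrBr; congr (_ * _).
have [->|ij] := eqVneq i j; first by rewrite tperm1 mul1g /swap_diff; ring.
rewrite (bigD1 i) //= (bigD1 j) /=; last by rewrite eq_sym.
rewrite [in RHS](bigD1 i) //= [in RHS](bigD1 j) /=; last by rewrite eq_sym.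
rewrite !permM tpermL tpermR /swap_diff.
rewrite (eq_bigr (fun k => score k (s k))); first by ring.
by move=> k /andP[ki kj]; rewrite permM tpermD // eq_sym.
Qed.

(** In the average of [swap_diff * g] the substitution of
    [tperm i j * s] for [s] changes the sign of [swap_diff] and moves the
    statistic by [swap_diff / sqrt n]; half the sum of the two expressions is
    the right-hand side. *)
Lemma stein_identity (g : R -> R) :
  cp_mean (fun s => cp_lin s * g (cp_lin s)) =
  (4 * rn)^-1 * \sum_i \sum_j swap_weight i j *
     cp_mean (fun s => swap_diff s i j *
                       (g (cp_lin s) - g (cp_lin s - rn^-1 * swap_diff s i j))).
Proof.
transitivity ((2 * rn)^-1 * \sum_i \sum_j swap_weight i j *
     cp_mean (fun s => swap_diff s i j * g (cp_lin s))).
  under eq_bigr do under eq_bigr do rewrite -cp_meanZ.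
  under eq_bigr do rewrite -cp_mean_sum.
  rewrite -cp_mean_sum -cp_meanZ; apply: eq_cp_mean => s sP.
  rewrite {1}cp_lin_swap_diff // -mulrA; congr (_ * _).
  rewrite mulr_suml; apply: eq_bigr => i _; rewrite mulr_suml.
  by apply: eq_bigr => j _; rewrite mulrA.
rewrite (_ : (2 * rn)^-1 = (4 * rn)^-1 * 2); last by field; rewrite gt_eqF.
rewrite -mulrA; congr (_ * _); rewrite big_distrr; apply: eq_bigr => i _ /=.
rewrite big_distrr; apply: eq_bigr => j _ /=.
rewrite mulrCA; have [ij|/eqP/negbTE ij] := obsZ D i =P obsZ D j; last first.
  by rewrite /swap_weight ij !mul0r.
congr (_ * _); have := cp_mean_swap (fun s => swap_diff s i j * g (cp_lin s)) ij.
under eq_cp_mean => s _ do rewrite swap_diff_tperm cp_lin_tperm.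
set a := cp_mean _; set b := cp_mean _ => ab.
rewrite mulr2n mulrDl mul1r -{1}ab -cp_meanD; apply: eq_cp_mean => s _.
by ring.
Qed.

End Statistic.
End SwapIdentity.

Section Bounds.
Variables (R : realType) (X Y Z : finType) (n : nat) (D : 'I_n -> X * Y * Z).
Hypothesis n_gt0 : (0 < n)%N.
Let rn : R := Num.sqrt n%:R.
Let rn_gt0 : 0 < rn. Proof. by rewrite sqrtr_gt0 ltr0n. Qed.
Let rnK : rn ^+ 2 = n%:R. Proof. by rewrite sqr_sqrtr. Qed.
Variables (t : X * Y * Z -> R) (C : R).
Hypothesis t_le : forall v, `|t v| <= C.
Implicit Types (s : 'S_n) (i j : 'I_n).
Local Notation w := (swap_weight R D).
Local Notation dl := (swap_diff D t).
Local Notation S := (cp_lin D t).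
Local Notation E := (cp_mean D).

Lemma sum_swap_weight2 : \sum_i \sum_j w i j = n%:R.
Proof. by under eq_bigr do rewrite sum_swap_weight; rewrite sumr_const card_ord. Qed.

Lemma swap_diff_bound s i j : `|dl s i j| <= 4 * C.
Proof.
have sc k l : - C <= score D t k l <= C by rewrite -ler_norml t_le.
rewrite /swap_diff ler_norml.
have := sc i (s i); have := sc j (s j); have := sc i (s j); have := sc j (s i); lra.
Qed.

(** The conditional variance of the exchangeable pair, suitably scaled: it
    takes the place of [sigma^2] in Stein's identity. *)
Definition swap_var s : R := (4 * n%:R)^-1 * \sum_i \sum_j w i j * dl s i j ^+ 2.

Lemma swap_var_mean (h : 'S_n -> R) : E (fun s => swap_var s * h s) =
  (4 * rn)^-1 * \sum_i \sum_j w i j * E (fun s => dl s i j * (rn^-1 * dl s i j * h s)).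
Proof.
rewrite (_ : (4 * rn)^-1 = (4 * n%:R)^-1 * rn); last first.
  by rewrite -rnK; field; rewrite gt_eqF.
rewrite -mulrA big_distrr /=; under [in RHS]eq_bigr do rewrite big_distrr /=.
under [in RHS]eq_bigr do under eq_bigr do rewrite mulrCA -cp_meanZ -cp_meanZ.
under [in RHS]eq_bigr do rewrite -cp_mean_sum.
rewrite -cp_mean_sum -cp_meanZ; apply: eq_cp_mean => s _.
rewrite -mulrA; congr (_ * _); rewrite mulr_suml; apply: eq_bigr => i _.
rewrite mulr_suml; apply: eq_bigr => j _.
by field; rewrite gt_eqF.
Qed.

Lemma swap_var_le s : swap_var s <= 4 * C ^+ 2.
Proof.
have C0 : 0 <= 4 * C by apply: le_trans (swap_diff_bound s (Ordinal n_gt0) (Ordinal n_gt0)).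
apply: (@le_trans _ _ ((4 * n%:R)^-1 * \sum_i \sum_j w i j * (4 * C) ^+ 2)).
  rewrite ler_wpM2l ?invr_ge0 ?mulr_ge0 //; apply: ler_sum => i _; apply: ler_sum => j _.
  rewrite ler_wpM2l ?swap_weight_ge0 // -ler_sqrt ?exprn_ge0 // !sqrtr_sqr (ger0_norm C0).
  exact: swap_diff_bound.
under eq_bigr do rewrite -mulr_suml.
rewrite -mulr_suml sum_swap_weight2 le_eqVlt; apply/orP; left; apply/eqP; field.
by rewrite pnatr_eq0 -lt0n.
Qed.

(** For [g = id] Stein's identity is an equality between the second moment
    and the mean of [swap_var]. *)
Lemma cp_lin_second_moment : E (fun s => S s ^+ 2) <= 4 * C ^+ 2.
Proof.
have -> : E (fun s => S s ^+ 2) = E (fun s => swap_var s * 1).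
  transitivity (E (fun s => S s * S s)); first by apply: eq_cp_mean.
  rewrite (stein_identity D n_gt0 t id) swap_var_mean; congr (_ * _).
  apply: eq_bigr => i _; apply: eq_bigr => j _; congr (_ * _); apply: eq_cp_mean => s _.
  by congr (_ * _); rewrite mulr1 opprB addrC subrK.
rewrite -[leRHS](cp_mean_cst D); apply: ler_cp_mean => s _; rewrite mulr1.
exact: swap_var_le.
Qed.

Lemma cp_lin_first_moment : E (fun s => `|S s|) <= 2 * C ^+ 2 + 1.
Proof.
apply: (@le_trans _ _ (E (fun s => 2^-1 * S s ^+ 2 + 1))).
  apply: ler_cp_mean => s _; rewrite -(real_normK (num_real (S s))).
  have := sqr_ge0 (`|S s| - 1); rewrite -subr_ge0.
  set x := `|S s|; nra.
rewrite cp_meanD cp_meanZ cp_mean_cst lerD2r.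
have := cp_lin_second_moment; lra.
Qed.

(** Stein's identity for [g = sin (u . + theta)], linearised by
    [sin_taylor]: each of the [n] units of total weight contributes an error
    of order [u^2 |swap_diff|^3 / n], with [|swap_diff| <= 4 C]. *)
Lemma stein_remainder (u theta : R) :
  `|E (fun s => S s * sin (u * S s + theta)) - u * E (fun s => swap_var s * cos (u * S s + theta))|
  <= 16 * C ^+ 3 * u ^+ 2 / rn.
Proof.
have C0 : 0 <= 4 * C.
  by apply: le_trans (swap_diff_bound 1%g (Ordinal n_gt0) (Ordinal n_gt0)).
rewrite (stein_identity D n_gt0 t (fun x => sin (u * x + theta))) -cp_meanZ -/rn.
under [X in _ - X]eq_cp_mean => s _ do rewrite mulrCA.
rewrite swap_var_mean -mulrBr -sumrB normrM ger0_norm ?invr_ge0 ?mulr_ge0 ?(ltW rn_gt0) //.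
rewrite ler_pdivrMl ?mulr_gt0 //.
rewrite (_ : 4 * _ * _ = \sum_i \sum_j w i j * (4 * C * (u * (rn^-1 * (4 * C))) ^+ 2)); last first.
  under eq_bigr do rewrite -mulr_suml.
  by rewrite -mulr_suml sum_swap_weight2 -rnK; field; rewrite gt_eqF.
apply: le_trans (ler_norm_sum _ _ _) _; apply: ler_sum => i _; rewrite -sumrB.
apply: le_trans (ler_norm_sum _ _ _) _; apply: ler_sum => j _; rewrite -mulrBr.
rewrite normrM ger0_norm ?swap_weight_ge0 // ler_wpM2l ?swap_weight_ge0 //.
rewrite -mulN1r -cp_meanZ -cp_meanD; apply: le_trans (cp_mean_norm _ _) _.
rewrite -[leRHS](cp_mean_cst D); apply: ler_cp_mean => s _.
set a := u * S s + theta; set b := u * (rn^-1 * dl s i j).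
have -> : u * (S s - (Num.sqrt n%:R)^-1 * dl s i j) + theta = a - b.
  by rewrite /a /b -/rn; ring.
have -> : dl s i j * (sin a - sin (a - b)) + -1 * (dl s i j * (rn^-1 * dl s i j * (u * cos a)))
   = dl s i j * (sin a - sin (a - b) - b * cos a) by rewrite /b; ring.
have d4 := swap_diff_bound s i j.
rewrite normrM; apply: ler_pM => //; apply: le_trans (sin_taylor _ _) _.
rewrite -real_normK ?num_real // -[leRHS]real_normK ?num_real //.
rewrite lerXn2r ?nnegrE // /b !normrM ler_wpM2l // ler_wpM2l //.
by apply: le_trans d4 _; rewrite -normrM ler_norm.
Qed.

End Bounds.

(** * Convergence of the characteristic functions *)

Section Concentration.
Variables (R : realType) (X Y Z : finType) (n : nat) (D : 'I_n -> X * Y * Z).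
Hypothesis n_gt0 : (0 < n)%N.
Let rn : R := Num.sqrt n%:R.
Let rn_gt0 : 0 < rn. Proof. by rewrite sqrtr_gt0 ltr0n. Qed.
Let rnK : rn ^+ 2 = n%:R. Proof. by rewrite sqr_sqrtr. Qed.
Implicit Types (s : 'S_n) (i j : 'I_n) (v : X * Y * Z).
Local Notation E := (cp_mean D).

Definition cross_diff2 (t : X * Y * Z -> R) v v' : R :=
  (v.2 == v'.2)%:R *
  (t v + t v' - t (v'.1.1, v.1.2, v.2) - t (v.1.1, v'.1.2, v.2)) ^+ 2.

Definition freq_star s v : R := phat_star D R s v.1.1 v.1.2 v.2.
Definition freq_prod v : R := phatX_Z D R v.1.1 v.2 * phatY_Z D R v.1.2 v.2 * phatZ D R v.2.

Lemma cross_diff2_ge0 t v v' : 0 <= cross_diff2 t v v'.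
Proof. by rewrite mulr_ge0 ?sqr_ge0. Qed.

(** The swap variance depends on the permutation through its table alone. *)
Lemma swap_varE t s : swap_var D t s =
  4^-1 * \sum_v \sum_v' cross_diff2 t v v' * (freq_star s v * freq_star s v' / phatZ D R v.2).
Proof.
pose F v v' := cross_diff2 t v v' / (countZ D v.2)%:R.
transitivity ((4 * n%:R)^-1 * \sum_i \sum_j F (permuted_obs D s i) (permuted_obs D s j)).
  congr (_ * _); apply: eq_bigr => i _; apply: eq_bigr => j _.
  rewrite /F /cross_diff2 /swap_weight /swap_diff /score /permuted_obs /=.
  by case: eqP => [->|_]; rewrite ?mul0r // mulrAC.
rewrite (sum_key (permuted_obs D s) (fun v => \sum_j F v (permuted_obs D s j))).
under eq_bigr => v _ do rewrite (sum_key (permuted_obs D s)) big_distrr /=.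
rewrite !big_distrr; apply: eq_bigr => v _; rewrite !big_distrr; apply: eq_bigr => v' _ /=.
rewrite -!cp_count_permuted_obs /F /freq_star /phat_star /phatZ !invfM invrK.
have n0 : (n%:R : R) != 0 by rewrite pnatr_eq0 -lt0n.
by set c := (countZ _ _)%:R^-1; field.
Qed.

Lemma freq_star_itv s v : 0 <= freq_star s v <= 1.
Proof.
rewrite /freq_star /phat_star mulr_ge0 ?invr_ge0 //= mulrC ler_pdivrMr ?ltr0n //.
rewrite mul1r ler_nat cp_count_permuted_obs; apply: (@leq_trans (\sum_(i < n) 1)%N).
  by apply: leq_sum => i _; case: eqP.
by rewrite sum1_card card_ord.
Qed.

Let ratio_itv (a b : nat) : (a <= b)%N -> 0 <= (a%:R / b%:R : R) <= 1.
Proof.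
move=> ab; rewrite mulr_ge0 ?invr_ge0 //=.
case: b ab => [|b] ab; first by rewrite invr0 mulr0.
by rewrite ler_pdivrMr ?ltr0n // mul1r ler_nat.
Qed.

Lemma freq_prod_itv v : 0 <= freq_prod v <= 1.
Proof.
have := @ratio_itv (countXZ D v.1.1 v.2) (countZ D v.2).
have := @ratio_itv (countYZ D v.1.2 v.2) (countZ D v.2).
have := @ratio_itv (countZ D v.2) n.
rewrite /freq_prod /phatX_Z /phatY_Z /phatZ.
case/(_ _)/andP.
  apply: (@leq_trans (\sum_(i < n) 1)%N); last by rewrite sum1_card card_ord.
  by apply: leq_sum => i _; case: eqP.
move=> a0 a1; case/(_ _)/andP; first by apply: leq_sum => i _; case: eqP.
move=> b0 b1; case/(_ _)/andP; first by apply: leq_sum => i _; case: eqP.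
move=> c0 c1; rewrite !mulr_ge0 //= mulr_ile1 ?mulr_ge0 //.
by rewrite mulr_ile1.
Qed.

(** [cp_lin_first_moment] for the indicator of the cell [v]. *)
Lemma freq_star_dev v : E (fun s => `|freq_star s v - freq_prod v|) <= 3 / rn.
Proof.
pose t v' : R := (v' == v)%:R.
have t1 v' : `|t v'| <= 1 by rewrite /t normr_nat lern1; case: eqP.
have := cp_lin_first_moment D n_gt0 t1; rewrite expr1n mulr1.
have -> : E (fun s => `|cp_lin D t s|) = rn * E (fun s => `|freq_star s v - freq_prod v|).
  rewrite -cp_meanZ; apply: eq_cp_mean => s _.
  rewrite /cp_lin (bigD1 v) //= /t eqxx mul1r big1 ?addr0 => [|v' /negbTE ->]; last by rewrite mul0r.
  by rewrite normrM ger0_norm // ltW.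
by rewrite ler_pdivlMr // mulrC; lra.
Qed.

Definition swap_var_prod (t : X * Y * Z -> R) : R :=
  4^-1 * \sum_v \sum_v' cross_diff2 t v v' * (freq_prod v * freq_prod v' / phatZ D R v.2).

Lemma swap_var_dev t : E (fun s => `|swap_var D t s - swap_var_prod t|) <=
  rn^-1 * \sum_v \sum_v' cross_diff2 t v v' * (2 / phatZ D R v.2).
Proof.
have pZ0 v : 0 <= (phatZ D R v.2)^-1 by rewrite invr_ge0 mulr_ge0 ?invr_ge0.
apply: (@le_trans _ _ (E (fun s => 4^-1 * \sum_v \sum_v' cross_diff2 t v v' / phatZ D R v.2 *
   (`|freq_star s v - freq_prod v| + `|freq_star s v' - freq_prod v'|)))).
  apply: ler_cp_mean => s sP; rewrite swap_varE -mulrBr normrM ger0_norm ?invr_ge0 //.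
  rewrite ler_wpM2l ?invr_ge0 // -sumrB; apply: le_trans (ler_norm_sum _ _ _) _.
  apply: ler_sum => v _; rewrite -sumrB; apply: le_trans (ler_norm_sum _ _ _) _.
  apply: ler_sum => v' _; rewrite -mulrBr -[leRHS]mulrA normrM ger0_norm ?cross_diff2_ge0 //.
  rewrite ler_wpM2l ?cross_diff2_ge0 // -mulrBl normrM [`|_^-1|]ger0_norm // mulrC.
  rewrite ler_wpM2l //.
  set a := freq_star s v; set b := freq_star s v'.
  set c := freq_prod v; set d := freq_prod v'.
  have -> : a * b - c * d = (a - c) * b + c * (b - d) by ring.
  have /andP[b0 b1] := freq_star_itv s v'; have /andP[c0 c1] := freq_prod_itv v.
  apply: le_trans (ler_normD _ _) _; rewrite (normrM (a - c)) (normrM c) lerD //.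
    by rewrite ler_piMr ?normr_ge0 ?(ger0_norm b0).
  by rewrite ler_piMl ?normr_ge0 ?(ger0_norm c0).
rewrite cp_meanZ.
have -> : rn^-1 * \sum_v \sum_v' cross_diff2 t v v' * (2 / phatZ D R v.2) =
   4^-1 * \sum_v \sum_v' cross_diff2 t v v' / phatZ D R v.2 * (8 / rn).
  rewrite !big_distrr; apply: eq_bigr => v _; rewrite !big_distrr; apply: eq_bigr => v' _ /=.
  set c := _^-1; set c' := (phatZ _ _ _)^-1; by field.
rewrite ler_wpM2l ?invr_ge0 // cp_mean_sum; apply: ler_sum => v _.
rewrite cp_mean_sum; apply: ler_sum => v' _; rewrite cp_meanZ.
rewrite ler_wpM2l ?(mulr_ge0 (cross_diff2_ge0 _ _ _) (pZ0 _)) // cp_meanD.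
apply: le_trans (lerD (freq_star_dev v) (freq_star_dev v')) _.
rewrite -mulrDl ler_wpM2r ?invr_ge0 ?(ltW rn_gt0) //; lra.
Qed.
End Concentration.

Section CharacteristicFunction.
Variables (R : realType) (X Y Z : finType) (n : nat) (D : 'I_n -> X * Y * Z).
Hypothesis n_gt0 : (0 < n)%N.
Variables (t : X * Y * Z -> R) (C : R).
Hypothesis t_le : forall v, `|t v| <= C.
Local Notation E := (cp_mean D).
Local Notation S := (cp_lin D t).

(** With [F u = E cos (u S + theta)], the function [exp (sigma2 u^2 / 2) F u]
    equals [cos theta] at [0], and by Stein's identity its derivative is
    [exp (sigma2 u^2 / 2)] times the error bounded here; integrate from [0]
    to [1]. *)
Lemma cp_lin_char_fun (sigma2 theta : R) : 0 <= sigma2 ->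
  `|E (fun s => cos (S s + theta)) - expR (- sigma2 / 2) * cos theta| <=
  E (fun s => `|swap_var D t s - sigma2|) + 16 * C ^+ 3 / Num.sqrt n%:R.
Proof.
move=> s0.
pose F u := E (fun s => cos (u * S s + theta)).
pose F' u := - E (fun s => S s * sin (u * S s + theta)).
pose e u : R := expR (sigma2 * u ^+ 2 / 2).
have dF u : is_derive u (1 : R) F (F' u).
  rewrite /F' /cp_mean -sumrN; apply: is_derive_fsum => s.
  have := is_derive_cos_affine (S s) theta u => h.
  by apply: is_derive_eq; rewrite ?scaler0 ?addr0 /GRing.scale /= mulrN.
have dG u : is_derive u (1 : R) (fun u => e u * F u) (e u * (sigma2 * u * F u + F' u)).
  have h1 := dF u; have h2 := is_derive_expR_sqr sigma2 u.
  have := is_deriveM h2 h1 => /is_derive_eq; apply.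
  by rewrite /GRing.scale /= /e; ring.
have [z z1 zE] := mean_value 0 1 dG.
have {}z1 : `|z| <= 1 by move: z1; rewrite !subr0 normr1.
have F1 : F 1 = E (fun s => cos (S s + theta)).
  by apply: eq_cp_mean => s _; rewrite mul1r.
have F0 : F 0 = cos theta.
  rewrite -[RHS](cp_mean_cst D); apply: eq_cp_mean => s _.
  by rewrite mul0r add0r.
have -> : E (fun s => cos (S s + theta)) - expR (- sigma2 / 2) * cos theta =
  expR (- sigma2 / 2) * (e z * (sigma2 * z * F z + F' z)).
  rewrite -[e z * _]mulr1 -[X in e z * _ * X](subr0 1) -zE -F1 -F0 /e.
  rewrite expr0n /= mulr0 mul0r expR0 mul1r mulrBr mulrA -expRD.
  by rewrite (_ : - sigma2 / 2 + _ = 0) ?expR0 ?mul1r //; field.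
rewrite mulrA normrM; apply: (@le_trans _ _ `|sigma2 * z * F z + F' z|).
  rewrite ler_piMl // -expRD ger0_norm ?expR_ge0 // -[leRHS]expR0 ler_expR.
  have : z ^+ 2 <= 1 by rewrite -real_normK ?num_real // expr_le1.
  by rewrite -subr_ge0 => /(mulr_ge0 s0); lra.
have sz : sigma2 * z * F z = z * E (fun s => sigma2 * cos (z * S s + theta)).
  by rewrite cp_meanZ /F; ring.
pose A := E (fun s => swap_var D t s * cos (z * S s + theta)).
have -> : sigma2 * z * F z + F' z =
    z * E (fun s => (sigma2 - swap_var D t s) * cos (z * S s + theta))
    - (E (fun s => S s * sin (z * S s + theta)) - z * A).
  rewrite sz /F' (_ : E (fun s => (_ - _) * _) =
     E (fun s => sigma2 * cos (z * S s + theta)) - A); first by ring.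
  rewrite /A -mulN1r -cp_meanZ -cp_meanD; apply: eq_cp_mean => s _; ring.
apply: le_trans (ler_normB _ _) _; apply: lerD.
  rewrite normrM; apply: le_trans (ler_piMl (normr_ge0 _) z1) _.
  apply: le_trans (cp_mean_norm _ _) _; apply: ler_cp_mean => s _.
  by rewrite normrM distrC ler_piMr // cos_max.
apply: le_trans (stein_remainder D n_gt0 t_le z theta) _.
have C0 : 0 <= C by apply: le_trans (t_le (D (Ordinal n_gt0))).
rewrite ler_wpM2r ?invr_ge0 ?sqrtr_ge0 // ler_piMr ?mulr_ge0 ?exprn_ge0 //.
by rewrite -real_normK ?num_real // expr_le1.
Qed.

End CharacteristicFunction.

Section Asymptotics.
Variables (R : realType) (X Y Z : finType) (p : X -> Y -> Z -> R).
Hypothesis pZ_gt0 : forall z, 0 < pZ p z.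
Variable D : forall n, 'I_n -> X * Y * Z.
Hypothesis cvgX : forall x z, phatX_Z (@D n) R x z @[n --> \oo] --> pX_Z p x z.
Hypothesis cvgY : forall y z, phatY_Z (@D n) R y z @[n --> \oo] --> pY_Z p y z.
Hypothesis cvgZ : forall z, phatZ (@D n) R z @[n --> \oo] --> pZ p z.

Definition limit_prob (v : X * Y * Z) : R := pX_Z p v.1.1 v.2 * pY_Z p v.1.2 v.2 * pZ p v.2.

Definition limit_var t : R := 4^-1 * \sum_v \sum_v'
  cross_diff2 t v v' * (limit_prob v * limit_prob v' / pZ p v.2).

Lemma cvg_freq_prod v : freq_prod R (@D n) v @[n --> \oo] --> limit_prob v.
Proof. by apply: cvgM; [apply: cvgM|]. Qed.

Lemma cvg_phatZV z : (phatZ (@D n) R z)^-1 @[n --> \oo] --> (pZ p z)^-1.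
Proof. by apply: cvgV => //; rewrite gt_eqF. Qed.

Lemma cvg_swap_var_prod t : swap_var_prod (@D n) t @[n --> \oo] --> limit_var t.
Proof.
apply: cvgM; first exact: cvg_cst.
apply: cvg_fsum => v; apply: cvg_fsum => v'; apply: cvgM; first exact: cvg_cst.
by apply: cvgM; [apply: cvgM; exact: cvg_freq_prod|exact: cvg_phatZV].
Qed.

Lemma limit_var_ge0 t : 0 <= limit_var t.
Proof.
rewrite -(cvg_lim _ (@cvg_swap_var_prod t)) //; apply: limr_ge.
  exact: cvgP (@cvg_swap_var_prod t).
apply: nearW => n /=; apply: mulr_ge0; first by rewrite invr_ge0.
apply: sumr_ge0 => v _; apply: sumr_ge0 => v' _.
rewrite mulr_ge0 ?cross_diff2_ge0 // !mulr_ge0 ?invr_ge0 ?mulr_ge0 ?invr_ge0 //.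
Qed.

Lemma cvg_cp_char_fun t theta :
  cp_mean (@D n) (fun s => cos (cp_lin (@D n) t s + theta)) @[n --> \oo]
  --> expR (- limit_var t / 2) * cos theta.
Proof.
pose C := \sum_v `|t v|.
have t_le v : `|t v| <= C by rewrite /C (bigD1 v) //= lerDl sumr_ge0.
pose rV n : R := (Num.sqrt (n%:R : R))^-1.
pose dev n := rV n * (\sum_v \sum_v' cross_diff2 t v v' * (2 / phatZ (@D n) R v.2))
  + `|swap_var_prod (@D n) t - limit_var t| + 16 * C ^+ 3 * rV n.
have dev0 : dev n @[n --> \oo] --> (0 : R).
  have r0 : rV n @[n --> \oo] --> (0 : R) by exact: cvg_invsqrt.
  rewrite [X in _ --> X](_ : 0 = 0 * (\sum_v \sum_v' cross_diff2 t v v' * (2 / pZ p v.2))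
    + `|limit_var t - limit_var t| + 16 * C ^+ 3 * 0); last by rewrite subrr normr0; ring.
  apply: cvgD; last by apply: cvgM => //; exact: cvg_cst.
  apply: cvgD; last first.
    by apply: cvg_norm; apply: cvgB; [exact: cvg_swap_var_prod|exact: cvg_cst].
  apply: cvgM => //; apply: cvg_fsum => v; apply: cvg_fsum => v'.
  apply: cvgM; first exact: cvg_cst; apply: cvgM; first exact: cvg_cst.
  exact: cvg_phatZV.
apply: (cvg_of_dist _ dev0) => n n0.
apply: le_trans (cp_lin_char_fun (@D n) n0 t_le theta (limit_var_ge0 t)) _.
rewrite lerD2r; apply: (@le_trans _ _ (cp_mean (@D n) (fun s =>
  `|swap_var (@D n) t s - swap_var_prod (@D n) t| + `|swap_var_prod (@D n) t - limit_var t|))).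
  by apply: ler_cp_mean => s _; apply: ler_distD.
by rewrite cp_meanD cp_mean_cst lerD2r swap_var_dev.
Qed.
End Asymptotics.

(** * Standard normal vectors *)

Section GaussianIntegral.
Variable R : realType.
Local Notation mu := (@lebesgue_measure R).
Local Notation phi := (@normal_pdf R 0 1).
Let K : R := normal_peak 1.
Let K_gt0 : 0 < K. Proof. by rewrite normal_peak_gt0. Qed.

Lemma std_normal_pdfE x : phi x = K * expR (-1 * x ^+ 2 / 2).
Proof.
rewrite normal_pdfE // /normal_fun subr0 expr1n mulN1r; congr (_ * expR (_ / _)).
Qed.

Lemma is_derive_std_normal_pdf (x : R) : is_derive x (1 : R) phi (- x * phi x).
Proof.
rewrite (_ : phi = fun x => K * expR (-1 * x ^+ 2 / 2)); last first.
  by apply/funext => y; rewrite std_normal_pdfE.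
have h := is_derive_expR_sqr (-1) x.
by apply: is_derive_eq; rewrite ?scaler0 ?addr0 /GRing.scale /=; ring.
Qed.

Let K2 : R := normal_peak (Num.sqrt 2).
Let K2_gt0 : 0 < K2. Proof. by rewrite normal_peak_gt0 // gt_eqF // sqrtr_gt0. Qed.

Let phi_continuous : continuous phi.
Proof. exact: continuous_of_derive is_derive_std_normal_pdf. Qed.

(** A multiple of the density of variance [2]: it is integrable and dominates
    [(1 + |x|) phi x], because [1 + |x| <= 2 exp (x^2 / 4)]. *)
Definition normal_dom x : R := K / K2 * normal_pdf 0 (Num.sqrt 2) x.

Lemma normal_domE x : normal_dom x = K * expR (- x ^+ 2 / 4).
Proof.
rewrite /normal_dom normal_pdfE ?gt_eqF ?sqrtr_gt0 // -/K2 /normal_fun subr0 sqr_sqrtr //.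
rewrite mulrA divfK ?gt_eqF //; congr (_ * expR (_ / _)); ring.
Qed.

Lemma integrable_normal_dom : mu.-integrable setT (EFin \o normal_dom).
Proof.
rewrite /comp; under eq_fun do rewrite EFinM.
by apply: integrableZl => //; exact: integrable_normal_pdf.
Qed.

Lemma normal_dom_bounds x (c : R) :
  (1 + `|c|) * (1 + `|x|) * phi x <= 2 * (1 + `|c|) * normal_dom x.
Proof.
rewrite std_normal_pdfE normal_domE (_ : -1 * x ^+ 2 / 2 = - x ^+ 2 / 4 + - x ^+ 2 / 4); last by field.
rewrite expRD; set e := expR (- x ^+ 2 / 4).
have e0 : 0 < e := expR_gt0 _.
have ee : e * (1 + x ^+ 2 / 4) <= 1.
  rewrite -[leRHS](_ : e * expR (x ^+ 2 / 4) = 1); last first.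
    by rewrite /e -expRD (_ : _ + _ = 0) ?expR0 //; field.
  by rewrite ler_wpM2l ?(ltW e0) // expR_ge1Dx.
have xx : 1 + `|x| <= 2 * (1 + x ^+ 2 / 4).
  have := sqr_ge0 (`|x| - 1); rewrite -(real_normK (num_real x)); set y := `|x|; nra.
have : e * (1 + `|x|) <= 2 by nra.
move: (normr_ge0 c) => c0 h.
have hK : 0 <= (1 + `|c|) * (K * e) by rewrite mulr_ge0 ?addr_ge0 ?mulr_ge0 ?(ltW K_gt0) ?(ltW e0).
have := ler_wpM2l hK h; lra.
Qed.

Lemma integrable_pdf_dominated (f : R -> R) (c : R) : measurable_fun setT f ->
  (forall x, `|f x| <= (1 + `|c|) * (1 + `|x|) * phi x) -> mu.-integrable setT (EFin \o f).
Proof.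
move=> mf fb.
have iG : mu.-integrable setT (EFin \o (fun x => 2 * (1 + `|c|) * normal_dom x)).
  rewrite /comp; under eq_fun do rewrite EFinM.
  by apply: integrableZl => //; exact: integrable_normal_dom.
apply: le_integrable iG => //; first exact/measurable_EFinP.
move=> x _ /=; rewrite lee_fin; apply: le_trans (fb x) _.
exact: le_trans (normal_dom_bounds _ _) (ler_norm _).
Qed.

Let phi0 x : 0 <= phi x := normal_pdf_ge0 0 1 x.

Let mphi : measurable_fun setT phi := measurable_normal_pdf 0 1.

Lemma measurable_cos_affine (a b : R) : measurable_fun setT (fun x : R => cos (x * a + b)).
Proof.
apply: continuous_measurable_fun; exact: continuous_of_derive (is_derive_cos_affine a b).
Qed.

Lemma is_derive_sin_affine (a b u : R) :
  is_derive u (1 : R) (fun x => sin (x * a + b)) (a * cos (u * a + b)).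
Proof.
have := is_derive_cos_affine a (b - pi / 2) u.
rewrite addrA sinBpihalf mulrN opprK; congr (is_derive _ _ _ _).
by apply/funext => y; rewrite addrA cosBpihalf.
Qed.

Lemma measurable_sin_affine (a b : R) : measurable_fun setT (fun x : R => sin (x * a + b)).
Proof.
apply: continuous_measurable_fun; exact: continuous_of_derive (is_derive_sin_affine a b).
Qed.

Lemma integrable_cos_pdf (t theta : R) :
  mu.-integrable setT (EFin \o (fun x => cos (x * t + theta) * phi x)).
Proof.
apply: (@integrable_pdf_dominated _ 0).
  by apply: measurable_funM => //; exact: measurable_cos_affine.
move=> x; rewrite normrM (ger0_norm (phi0 x)) normr0 addr0 mul1r ler_wpM2r //.
by apply: le_trans (cos_max _) _; rewrite lerDl.
Qed.

Lemma integrable_xsin_pdf (t theta : R) :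
  mu.-integrable setT (EFin \o (fun x => x * sin (x * t + theta) * phi x)).
Proof.
apply: (@integrable_pdf_dominated _ 0).
  apply: measurable_funM => //; apply: measurable_funM => //.
  exact: measurable_sin_affine.
move=> x; rewrite normrM (ger0_norm (phi0 x)) normr0 addr0 mul1r ler_wpM2r //.
by rewrite normrM; apply: le_trans (ler_piMr _ (sin_max _)) _; rewrite // lerDr.
Qed.

(** The integrand of the difference is minus the derivative of
    [sin (x t + theta) phi x], which vanishes at both infinities; the integral
    over the line is the limit of those over [[-n, n]]. *)
Lemma gaussian_by_parts (t theta : R) :
  (\int[mu]_x (x * sin (x * t + theta) * phi x) = t * \int[mu]_x (cos (x * t + theta) * phi x))%R.
Proof.
pose F x := sin (x * t + theta) * phi x.
pose f x := t * (cos (x * t + theta) * phi x) - x * sin (x * t + theta) * phi x.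
have dF (x : R) : is_derive x (1 : R) F (f x).
  have h1 := is_derive_std_normal_pdf x.
  have h2 := is_derive_sin_affine t theta x.
  have := is_deriveM h2 h1 => /is_derive_eq; apply.
  by rewrite /GRing.scale /= /f; ring.
have cF := continuous_of_derive dF.
have intc : mu.-integrable setT (EFin \o (fun x => t * (cos (x * t + theta) * phi x))).
  rewrite /comp; under eq_fun do rewrite EFinM.
  by apply: integrableZl => //; exact: integrable_cos_pdf.
have intf : mu.-integrable setT (EFin \o f).
  rewrite /comp; under eq_fun do rewrite EFinB.
  by apply: integrableB => //; exact: integrable_xsin_pdf.
suff : \int[mu]_x f x = 0.
  rewrite RintegralB //; last exact: integrable_xsin_pdf.
  rewrite RintegralZl //; last exact: integrable_cos_pdf.
  by move/eqP; rewrite subr_eq0 => /eqP.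
have cf : continuous f.
  move=> x; apply: cvgB.
    apply: cvgM; first exact: cvg_cst.
    apply: cvgM; last exact: phi_continuous.
    exact: (continuous_of_derive (is_derive_cos_affine t theta)).
  apply: cvgM; last exact: phi_continuous.
  apply: cvgM; first exact: cvg_id.
  exact: (continuous_of_derive (is_derive_sin_affine t theta)).
have FTC n : \int[mu]_x (f \_ `[- n.+1%:R, n.+1%:R]) x = F n.+1%:R - F (- n.+1%:R).
  have nn : - (n.+1%:R) < n.+1%:R :> R by have := ltr0Sn R n; lra.
  rewrite -Rintegral_mkcond /Rintegral (continuous_FTC2 (F := F) nn) //.
  - exact: continuous_subspaceT.
  - split => [y _||].
    + by have := dF y => /@ex_derive.
    + exact/cvg_at_right_filter/cF.
    + exact/cvg_at_left_filter/cF.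
  - by move=> y _; rewrite derive1E; have := dF y => h; rewrite derive_val.
have lim1 : \int[mu]_x (f \_ `[- n.+1%:R, n.+1%:R]) x @[n --> \oo] --> \int[mu]_x f x.
  apply: fine_cvg; rewrite fineK; last exact: integrable_fin_num.
  have mf : measurable_fun setT f by exact: continuous_measurable_fun.
  apply: (@dominated_cvg _ _ _ mu setT _ (fun n x => ((f \_ `[- n.+1%:R, n.+1%:R]) x)%:E)
     (EFin \o f) (fun x => (`|f x|)%:E)) => //.
  - move=> n; apply/measurable_EFinP.
    have mI : measurable (`[- n.+1%:R, n.+1%:R] : set R) by exact: measurable_itv.
    exact: (measurable_restrictT f mI).1 (measurable_funTS mf).
  - move=> x _; apply: cvg_near_cst; near=> n.
    rewrite /= patchE mem_set //= in_itv /= -ler_norml.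
    near: n; exists (Num.truncn `|x|).+1 => // n /= xn.
    rewrite (le_trans (ltW (truncnS_gt _))) // ler_nat (leq_trans xn) //.
  - exact: integrable_abse intf.
  - by move=> n x _; rewrite lee_fin patchE; case: ifPn => // _; rewrite normr0.
have phin (x : R) n : n.+1%:R <= `|x| -> `|F x| <= 2 * K * n.+1%:R^-1.
  move=> nx; rewrite /F normrM (ger0_norm (phi0 x)).
  apply: le_trans (ler_piMl _ (sin_max _)) _ => //.
  have dK : normal_dom x <= K.
    rewrite normal_domE ler_piMr ?(ltW K_gt0) // -[leRHS]expR0 ler_expR.
    by have := sqr_ge0 x; lra.
  have := normal_dom_bounds x 0; rewrite normr0 addr0 mul1r mulr1 => h.
  rewrite ler_pdivlMr ?ltr0n //; apply: (@le_trans _ _ ((1 + `|x|) * phi x)); last by lra.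
  by rewrite mulrC ler_wpM2r //; lra.
have lim2 : F n.+1%:R - F (- n.+1%:R) @[n --> \oo] --> (0 : R).
  apply: (@cvg_of_dist _ _ (fun n => 4 * K * n.+1%:R^-1)).
    move=> n _; rewrite subr0; apply: le_trans (ler_normB _ _) _.
    rewrite (_ : 4 * K = 2 * K + 2 * K); last by ring.
    by rewrite mulrDl lerD //; apply: phin; rewrite ?normrN ger0_norm.
  rewrite [X in _ --> X](_ : 0 = 4 * K * 0); last by rewrite mulr0.
  by apply: cvgM; [exact: cvg_cst|exact: cvg_harmonic].
move: lim1; under eq_cvg do rewrite FTC.
by move=> lim1; apply: (cvg_unique _ lim1 lim2).
Unshelve. all: by end_near. Qed.

(** Differentiating in [t] under the integral and integrating by parts gives
    [H' = - t H], so that [exp (t^2 / 2) H t] is constant. *)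
Lemma gaussian_char_fun (t theta : R) :
  (\int[mu]_x (cos (x * t + theta) * phi x))%R = expR (- t ^+ 2 / 2) * cos theta.
Proof.
pose H (u : R) : R := (\int[mu]_x (cos (x * u + theta) * phi x))%R.
pose f (u x : R) : R := cos (x * u + theta) * phi x.
have df u x : is_derive u (1 : R) (f ^~ x) (- (x * sin (x * u + theta) * phi x)).
  have h := is_derive_cos_affine x theta u.
  rewrite (_ : f ^~ x = fun u => cos (u * x + theta) * phi x); last first.
    by apply/funext => v; rewrite /f (mulrC x).
  by apply: is_derive_eq; rewrite scaler0 ?addr0 ?add0r /GRing.scale /= (mulrC u x); ring.
have d1f u x : partial1of2 f u x = - (x * sin (x * u + theta) * phi x).
  by rewrite partial1of2E; have := df u x => h; rewrite derive_val.
have dH u : is_derive u (1 : R) H (- u * H u).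
  have Iu : `]u - 1, u + 1[%classic u by rewrite /= in_itv /= ltrBlDr ltrDl ltr01 andbT.
  have iG : mu.-integrable setT (EFin \o (fun x => 2 * normal_dom x)).
    rewrite /comp; under eq_fun do rewrite EFinM.
    by apply: integrableZl => //; exact: integrable_normal_dom.
  have nd0 x : 0 <= normal_dom x by rewrite normal_domE mulr_ge0 ?expR_ge0 ?(ltW K_gt0).
  have if_ v : `]u - 1, u + 1[%classic v -> mu.-integrable setT (EFin \o f v).
    by move=> _; exact: integrable_cos_pdf.
  have dfb v x : `]u - 1, u + 1[%classic v -> setT x -> derivable (f ^~ x) v 1.
    by move=> _ _; have := df v x => /@ex_derive.
  have G0 x : 0 <= 2 * normal_dom x by rewrite mulr_ge0.
  have Gub v x : `]u - 1, u + 1[%classic v -> setT x -> `|partial1of2 f v x| <= 2 * normal_dom x.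
    move=> _ _; rewrite d1f normrN.
    have := normal_dom_bounds x 0; rewrite normr0 addr0 mul1r mulr1; apply: le_trans.
    rewrite normrM (ger0_norm (phi0 x)) ler_wpM2r // normrM.
    by apply: le_trans (ler_piMr _ (sin_max _)) _; rewrite // lerDr.
  have dHu := derivable_under_integral measurableT Iu if_ dfb G0 iG Gub.
  have dHE := differentiation_under_integral measurableT Iu if_ dfb G0 iG Gub.
  apply: DeriveDef; first exact: dHu.
  rewrite -derive1E [LHS]dHE; under eq_Rintegral do rewrite d1f -mulN1r.
  rewrite RintegralZl //; last exact: integrable_xsin_pdf.
  by rewrite gaussian_by_parts /H; ring.
have dL u : is_derive u (1 : R) (fun u => expR (1 * u ^+ 2 / 2) * H u) 0.
  have h1 := dH u; have h2 := is_derive_expR_sqr 1 u.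
  have := is_deriveM h2 h1 => /is_derive_eq; apply.
  by rewrite /GRing.scale /=; ring.
have [z _] := mean_value 0 t dL.
rewrite mul0r => /eqP; rewrite subr_eq0 => /eqP.
rewrite expr0n /= mulr0 mul0r expR0 !mul1r => Ht.
have -> : (\int[mu]_x (cos (x * t + theta) * phi x))%R = expR (- t ^+ 2 / 2) * H 0.
  rewrite -Ht mulrA -expRD (_ : _ + _ = 0) ?expR0 ?mul1r //; by field.
congr (_ * _); rewrite /H; under eq_Rintegral do rewrite mulr0 add0r.
rewrite RintegralZl //; last exact: integrable_normal_pdf.
by rewrite /Rintegral integral_normal_pdf mulr1.
Qed.

Local Notation gauss := (@normal_prob R 0 1).

(** The Radon-Nikodym derivative of the law is its density. *)
Lemma integral_std_normal_prob (f : R -> \bar R) : gauss.-integrable setT f ->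
  (\int[gauss]_x f x = \int[mu]_x (f x * (phi x)%:E))%E.
Proof.
move=> intf; have mf := measurable_int _ intf.
have dom := normal_prob_dominates (0 : R) 1.
rewrite -(Radon_Nikodym_change_of_variables dom) //=.
apply: ae_eq_integral => //.
- by apply: emeasurable_funM => //; apply: (measurable_int mu).
- by apply: emeasurable_funM => //; exact/measurable_EFinP.
- apply: ae_eqe_mul2l => /=.
  rewrite Radon_NikodymE //=.
  case: cid => /= h [h1 h2 h3].
  apply: integral_ae_eq => //=.
  + exact/measurable_EFinP.
  + by move=> E E01 mE; rewrite -h3.
Qed.

Lemma expectation_cos_std_normal (t theta : R) :
  (\int[gauss]_x (cos (x * t + theta))%:E = (expR (- t ^+ 2 / 2) * cos theta)%:E)%E.
Proof.
have intc : gauss.-integrable setT (EFin \o (fun x : R => cos (x * t + theta))).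
  apply: (@measurable_bounded_integrable _ _ _ gauss) => //.
  - by rewrite /= probability_setT ltry.
  - exact: measurable_cos_affine.
  - by exists 1; split => // M M1 x _; exact: le_trans (cos_max _) (ltW M1).
rewrite integral_std_normal_prob // -gaussian_char_fun /Rintegral fineK //.
exact: integrable_fin_num (integrable_cos_pdf t theta).
Qed.

End GaussianIntegral.

Section StandardNormalVector.
Variable R : realType.

Lemma integrable_bounded_cos d (T : measurableType d) (P : probability T R) (f : T -> R) :
  measurable_fun setT f -> P.-integrable setT (EFin \o (fun w => cos (f w))).
Proof.
move=> mf; apply: (@measurable_bounded_integrable _ _ _ P) => //.
- by rewrite /= probability_setT ltry.
- by apply: (measurableT_comp _ mf); apply: continuous_measurable_fun; exact: continuous_cos.
- by exists 1; split => // M M1 x _; exact: le_trans (cos_max _) (ltW M1).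
Qed.

(** Induction on [k], adjoining one coordinate with a product measure. The
    characteristic function is carried along the induction, by Fubini's
    theorem, so that no general fact on laws of vectors is needed. *)
Lemma exists_std_normal_vector (k : nat) :
  exists (d : measure_display) (T : measurableType d) (P : probability T R) (N : T -> 'rV[R]_k),
    std_normal_vector P N /\
    forall (t : 'I_k -> R) (theta : R),
      (\int[P]_w (cos (\sum_i N w 0 i * t i + theta))%:E =
       (expR (- (\sum_i t i ^+ 2) / 2) * cos theta)%:E)%E.
Proof.
elim: k => [|k [d [T [P [N [[mN PN] cfN]]]]]].
  pose G : probability (measurableTypeR R) R := normal_prob 0 1.
  exists _, (measurableTypeR R), G, (fun=> 0); split; last first.
    move=> t theta; rewrite !big_ord0 add0r oppr0 mul0r expR0 mul1r.
    by rewrite integral_cst // [X in (_ * X)%E](@probability_setT _ _ _ G) mule1.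
  split=> [[]//|B _]; rewrite big_ord0.
  rewrite (_ : [set _ | _] = setT); first exact: (@probability_setT _ _ _ G).
  by apply/seteqP; split => // x _ [].
pose G : probability (measurableTypeR R) R := normal_prob 0 1.
pose N' (xw : measurableTypeR R * T) : 'rV[R]_k.+1 :=
  \row_i if unlift ord0 i is Some j then N xw.2 0 j else xw.1.
have N'0 xw : N' xw 0 ord0 = xw.1 by rewrite mxE unlift_none.
have N'S xw j : N' xw 0 (lift ord0 j) = N xw.2 0 j by rewrite mxE liftK.
exists _, (measurableTypeR R * T)%type, (G \x P)%E, N'; split.
  split=> [i|B mB].
    have [j ->|->] := unliftP ord0 i.
      under eq_fun do rewrite N'S.
      exact: (measurableT_comp (mN j) measurable_snd).
    under eq_fun do rewrite N'0.
    exact: measurable_fst.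
  rewrite (_ : [set _ | _] =
     B ord0 `*` [set w | forall j, B (lift ord0 j) (N w 0 j)]); last first.
    apply/seteqP; split => [xw h /=|xw /= [h0 hS] i].
      split; first by have := h ord0; rewrite N'0.
      by move=> j; have := h (lift ord0 j); rewrite N'S.
    by have [j ->|->] := unliftP ord0 i; rewrite ?N'S ?N'0.
  have mBS : measurable [set w | forall j, B (lift ord0 j) (N w 0 j)].
    rewrite (_ : [set _ | _] = \bigcap_(j in setT) ((fun w => N w 0 j) @^-1` B (lift ord0 j))).
      apply: fin_bigcap_measurable => // j _; rewrite -[_ @^-1` _]setTI.
      exact: mN.
    by apply/seteqP; split => [w h j _|w h j]; [exact: h|exact: (h j I)].
  apply: etrans (product_measure1E G P (mB ord0) mBS) _.
  by rewrite big_ord_recl -(PN (fun j => B (lift ord0 j))).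
move=> t theta.
pose f xw : R := xw.1 * t ord0 + (\sum_j N xw.2 0 j * t (lift ord0 j) + theta).
have mS : measurable_fun setT (fun w => \sum_j N w 0 j * t (lift ord0 j) + theta).
  apply: measurable_funD => //; apply: measurable_sum => j.
  by apply: measurable_funM.
have mf : measurable_fun setT f.
  apply: measurable_funD; first by apply: measurable_funM => //; exact: measurable_fst.
  exact: (measurableT_comp mS measurable_snd).
transitivity (\int[(G \x P)%E]_xw (cos (f xw))%:E)%E.
  apply: eq_integral => xw _; rewrite big_ord_recl N'0 /f addrA; congr ((cos (_ + _ + _))%:E).
  by apply: eq_bigr => j _; rewrite N'S.
apply: etrans (esym (@integral21_prod_meas1 _ _ _ _ R G P _
  (integrable_bounded_cos (G \x P)%E mf))) _.
rewrite /fubini_G.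
transitivity (\int[P]_w ((expR (- t ord0 ^+ 2 / 2))%:E *
    (cos (\sum_j N w 0 j * t (lift ord0 j) + theta))%:E))%E.
  apply: eq_integral => w _; rewrite -EFinM /= /f /= /G.
  have H := expectation_cos_std_normal (t ord0)
    (\sum_j N w 0 j * t (lift ord0 j) + theta).
  exact H.
rewrite integralZl //; last exact: integrable_bounded_cos.
rewrite cfN -EFinM mulrA -expRD big_ord_recl; congr (expR _ * _)%:E; ring.
Qed.

End StandardNormalVector.

(** * Bernstein approximation on the unit cube *)

Section Bernstein.
Variable R : realType.
Implicit Types (m j : nat) (u : R).

Definition bernstein m j u : R := 'C(m, j)%:R * u ^+ j * (1 - u) ^+ (m - j).

Lemma bernstein_ge0 m j u : 0 <= u <= 1 -> 0 <= bernstein m j u.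
Proof. by move=> /andP[u0 u1]; rewrite !mulr_ge0 ?exprn_ge0 // subr_ge0. Qed.

(** The Bernstein weights are the coefficients of [((1 - u) + u X)^m]; their
    moments are the derivatives of this polynomial at [1]. *)
Lemma bernstein_poly m u :
  ((1 - u)%:P + u *: 'X) ^+ m = \sum_(j < m.+1) bernstein m j u *: 'X^j.
Proof.
rewrite exprDn; apply: eq_bigr => j _.
rewrite exprZn -polyC_exp mul_polyC scalerA scalerMnl -scalerMnl scalerMnl -mulr_natr.
by congr (_ *: _); rewrite /bernstein; ring.
Qed.

Lemma bernstein_sum1 m u : \sum_(j < m.+1) bernstein m j u = 1.
Proof.
have := congr1 (fun q : {poly R} => q.[1]) (bernstein_poly m u).
rewrite horner_exp !hornerE subrK expr1n horner_sum => ->.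
by apply: eq_bigr => j _; rewrite !hornerE expr1n mulr1.
Qed.

Lemma deriv_bernstein_base u : ((1 - u)%:P + u *: 'X)^`() = u%:P.
Proof. by rewrite derivD derivC derivZ derivX add0r alg_polyC. Qed.

Lemma bernstein_mean m u : \sum_(j < m.+1) j%:R * bernstein m j u = m%:R * u.
Proof.
have := congr1 (fun q : {poly R} => q^`().[1]) (bernstein_poly m u).
rewrite deriv_exp deriv_bernstein_base hornerMn !hornerE subrK expr1n mulr1 => e.
rewrite mulr_natl e raddf_sum horner_sum; apply: eq_bigr => j _ /=.
by rewrite derivZ derivXn hornerZ hornerMn hornerXn expr1n mulrC.
Qed.

Lemma bernstein_mean2 m u :
  \sum_(j < m.+1) (j * j.-1)%:R * bernstein m j u = (m * m.-1)%:R * u ^+ 2.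
Proof.
have := congr1 (fun q : {poly R} => q^`()^`().[1]) (bernstein_poly m u).
set S := \sum_(j < m.+1) _ * _; set T := _%:R * u ^+ 2.
rewrite deriv_exp deriv_bernstein_base derivMn deriv_mulC deriv_exp deriv_bernstein_base.
rewrite !hornerMn !hornerE hornerMn !hornerE subrK expr1n mulr1 => e.
rewrite (_ : T = u * (u *+ m.-1) *+ m); last first.
  by rewrite /T natrM -[in RHS]mulr_natr -[in RHS]mulr_natr; ring.
rewrite e {}/S !raddf_sum horner_sum; apply: eq_bigr => j _ /=.
rewrite !derivZ derivXn derivMn derivXn hornerZ !hornerMn hornerXn expr1n.
by rewrite natrM -[in RHS]mulr_natr; ring.
Qed.

Lemma bernstein_var m u : (0 < m)%N ->
  \sum_(j < m.+1) bernstein m j u * (j%:R / m%:R - u) ^+ 2 = u * (1 - u) / m%:R.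
Proof.
move=> m0; have mR : (m%:R : R) != 0 by rewrite pnatr_eq0 -lt0n.
have E j : (j * j.-1)%:R = j%:R ^+ 2 - j%:R :> R.
  by case: j => [|j]; rewrite /= ?mul0n ?expr0n ?subrr // natrM -[j.+1]addn1 natrD; ring.
transitivity (m%:R^-2 * (\sum_(j < m.+1) (j * j.-1)%:R * bernstein m j u)
   + (m%:R^-2 - 2 * u / m%:R) * (\sum_(j < m.+1) j%:R * bernstein m j u)
   + u ^+ 2 * (\sum_(j < m.+1) bernstein m j u)).
  rewrite !big_distrr -!big_split; apply: eq_bigr => j _ /=; rewrite E.
  by field.
rewrite bernstein_mean2 bernstein_mean bernstein_sum1 E.
by field.
Qed.
End Bernstein.

Section TensorBernstein.
Variables (R : realType) (k m : nat).
Hypothesis m_gt0 : (0 < m)%N.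
Implicit Types (u : 'rV[R]_k) (a : {ffun 'I_k -> 'I_m.+1}).

Definition node a : 'rV[R]_k := \row_i ((a i)%:R / m%:R).
Definition tensor_weight a u : R := \prod_i bernstein m (a i) (u 0 i).
Definition unit_cube : set 'rV[R]_k := [set u | forall i, 0 <= u 0 i <= 1].

Lemma node_cube a : unit_cube (node a).
Proof.
move=> i; rewrite mxE mulr_ge0 ?invr_ge0 //= ler_pdivrMr ?ltr0n // mul1r ler_nat.
by rewrite -ltnS ltn_ord.
Qed.

Lemma tensor_weight_ge0 a u : unit_cube u -> 0 <= tensor_weight a u.
Proof. by move=> cu; apply: prodr_ge0 => i _; exact: bernstein_ge0. Qed.

Lemma tensor_weight_sum1 u : \sum_a tensor_weight a u = 1.
Proof.
rewrite /tensor_weight.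
rewrite -(bigA_distr_bigA (fun i (j : 'I_m.+1) => bernstein m j (u 0 i))).
by apply: big1 => i _; exact: bernstein_sum1.
Qed.

(** The weights are a product law whose [i]-th marginal is binomial. *)
Lemma tensor_weight_var u i : unit_cube u ->
  \sum_a tensor_weight a u * (node a 0 i - u 0 i) ^+ 2 <= m%:R^-1.
Proof.
move=> cu.
pose G i' (j : 'I_m.+1) := bernstein m j (u 0 i') *
  (if i' == i then (j%:R / m%:R - u 0 i) ^+ 2 else 1).
rewrite (eq_bigr (fun a => \prod_i' G i' (a i'))); last first.
  move=> a _; rewrite /G big_split /=; congr (_ * _).
  by rewrite -big_mkcond big_pred1_eq mxE.
rewrite -(bigA_distr_bigA G) (bigD1 i) //= [X in _ * X]big1 ?mulr1; last first.
  move=> i' /negbTE ii; rewrite /G; under eq_bigr do rewrite ii mulr1.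
  exact: bernstein_sum1.
rewrite /G; under eq_bigr do rewrite eqxx.
rewrite bernstein_var // ler_piMl ?invr_ge0 //.
by have /andP[] := cu i; nra.
Qed.

(** The node weights are probabilities; where a node differs from [u] by at
    least [dl] in some coordinate, bound the oscillation by [2 M] and the
    probability by Chebyshev's inequality. *)
Lemma tensor_bernstein_approx (F : 'rV[R]_k -> R) (M e dl : R) u :
  0 < dl -> (forall v, `|F v| <= M) -> unit_cube u ->
  (forall v, unit_cube v -> (forall i, `|v 0 i - u 0 i| < dl) -> `|F v - F u| <= e) ->
  0 <= e ->
  `|\sum_a F (node a) * tensor_weight a u - F u| <= e + 2 * M * k%:R / dl ^+ 2 / m%:R.
Proof.
move=> dl0 FM cu Fu e0.
have M0 : 0 <= M by apply: le_trans (FM 0).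
have -> : F u = \sum_a F u * tensor_weight a u.
  by rewrite -big_distrr /= tensor_weight_sum1 mulr1.
rewrite -sumrB.
apply: le_trans (ler_norm_sum _ _ _) _.
apply: (@le_trans _ _ (\sum_a tensor_weight a u *
   (e + \sum_i 2 * M / dl ^+ 2 * (node a 0 i - u 0 i) ^+ 2))).
  apply: ler_sum => a _; rewrite -mulrBl mulrC normrM ger0_norm ?tensor_weight_ge0 //.
  rewrite ler_wpM2l ?tensor_weight_ge0 //.
  have term0 i : 0 <= 2 * M / dl ^+ 2 * (node a 0 i - u 0 i) ^+ 2.
    by rewrite mulr_ge0 ?sqr_ge0 // mulr_ge0 ?invr_ge0 ?sqr_ge0 ?mulr_ge0.
  have [h|/forallPn[i]] := boolP [forall i, `|node a 0 i - u 0 i| < dl].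
    apply: le_trans (Fu _ (node_cube a) _) _; first by move=> i; exact: (forallP h).
    by rewrite lerDl sumr_ge0.
  rewrite -leNgt => dli; apply: le_trans (ler_normB _ _) _.
  apply: le_trans (lerD (FM _) (FM _)) _.
  apply: (@le_trans _ _ (2 * M / dl ^+ 2 * (node a 0 i - u 0 i) ^+ 2)); last first.
    by rewrite (bigD1 i) //= addrCA lerDl addr_ge0 // sumr_ge0.
  rewrite -[leRHS]mulrA (_ : M + M = 2 * M); last by ring.
  rewrite ler_peMr ?mulr_ge0 // mulrC ler_pdivlMr ?exprn_gt0 // mul1r.
  by rewrite -[leRHS]real_normK ?num_real // lerXn2r ?nnegrE ?(ltW dl0).
under eq_bigr do rewrite mulrDr big_distrr.
rewrite big_split /= -mulr_suml tensor_weight_sum1 mul1r lerD2l exchange_big /=.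
rewrite (_ : 2 * M * k%:R / dl ^+ 2 / m%:R = \sum_(i < k) 2 * M / dl ^+ 2 * m%:R^-1); last first.
  rewrite sumr_const card_ord -mulr_natl; set c := _^-1; set c' := m%:R^-1; ring.
apply: ler_sum => i _; under eq_bigr do rewrite mulrCA.
rewrite -big_distrr /= ler_wpM2l ?tensor_weight_var //.
by rewrite mulr_ge0 ?invr_ge0 ?sqr_ge0 ?mulr_ge0.
Qed.

End TensorBernstein.

(** * Approximation by trigonometric polynomials *)

Section CompactUniformContinuity.
Variables (R : realType) (k : nat).

Lemma continuous_row (T : topologicalType) (f : 'I_k -> T -> R) :
  (forall i, continuous (f i)) -> continuous (fun x => \row_i f i x : 'rV[R]_k).
Proof.
move=> cf x; apply/cvg_ballP => e e0.
have h : \forall y \near x, forall i, ball (f i x) e (f i y).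
  by apply: filter_forall => i; have /cvg_ballP := cf i x; exact.
near=> y; split => // a i; rewrite !mxE.
by move: i; near: y.
Unshelve. all: by end_near. Qed.

Lemma compact_uniform_continuity (A : set 'rV[R]_k) (F : 'rV[R]_k -> R) (e : R) :
  compact A -> continuous F -> 0 < e ->
  exists2 dl, 0 < dl & forall u v : 'rV[R]_k, A u ->
    (forall i, `|v 0 i - u 0 i| < dl) -> `|F v - F u| < e.
Proof.
move=> /compact_near_coveringP cA cF e0.
pose P (dl : R) (u : 'rV[R]_k) := forall v : 'rV[R]_k,
  (forall i, `|v 0 i - u 0 i| < dl) -> `|F v - F u| < e.
have : \forall dl \near (0 : R)^'+, A `<=` P dl.
  apply: cA => x _.
  have /cvgrPdist_lt/(_ (e / 2)) := cF x; rewrite divr_gt0 // => /(_ isT).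
  move=> /nbhs_ballP[r /= r0 xr].
  have xr2 : nbhs x (ball x (r / 2)) by apply: nbhsx_ballx; rewrite divr_gt0.
  near=> x' dl => v /= vx.
  have x'r : ball x (r / 2) x' by near: x'.
  have dlr : dl < r / 2 by near: dl; apply: nbhs_right_lt; rewrite divr_gt0.
  have bx' : ball x r x' by apply: le_ball x'r; rewrite ler_pdivrMr // ler_peMr ?ler1n // ltW.
  have bv : ball x r v.
    split => // a i; rewrite ord1 /ball /=; have /= [_ /(_ 0 i)] := x'r.
    rewrite /ball /= => h1; have h2 := vx i.
    have := ler_distD (x' 0 i) (x 0 i) (v 0 i).
    rewrite (distrC (x' 0 i) (v 0 i)); lra.
  have := ler_distD (F x) (F v) (F x'); have := xr _ bx'; have := xr _ bv.
  rewrite /= (distrC (F x) (F v)); lra.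
move=> AP; near ((0 : R)^'+) => dl; exists dl => //.
by move=> u v Au uv; have /(_ _ Au _ uv) : A `<=` P dl by near: dl.
Unshelve. all: by end_near. Qed.
End CompactUniformContinuity.

(** The sine maps [[-1/2, 1/2]] to a segment inside the open interval
    [(-1, 1)], on which [asin] is continuous. The inverse clamps its argument
    to that segment: this makes it continuous on the whole space, and harmless
    on the image of the cube of radius [K]. *)
Section SineSubstitution.
Variables (R : realType) (k : nat) (K : R).
Hypothesis K_gt0 : 0 < K.
Let s1 : R := sin (2^-1).

Let sin1 : 0 <= s1 < 1.
Proof.
have h := @pihalf_ge1 R.
rewrite /s1 -[X in _ < X]sin_pihalf ltr_sin ?in_itv /=; try lra.
by rewrite ltW ?sin_gt0_pihalf //; lra.
Qed.

Definition sine_coord (x : 'rV[R]_k) : 'rV[R]_k := \row_i ((1 + sin (x 0 i / (2 * K))) / 2).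
Definition sine_coord_inv (u : 'rV[R]_k) : 'rV[R]_k :=
  \row_i (2 * K * asin (Num.min s1 (Num.max (- s1) (2 * u 0 i - 1)))).

Lemma sine_coord_cube x : unit_cube (sine_coord x).
Proof.
move=> i; rewrite mxE; have := sin_geN1 (x 0 i / (2 * K)); have := sin_le1 (x 0 i / (2 * K)).
by lra.
Qed.

Lemma sine_coordK (x : 'rV[R]_k) : (forall i, `|x 0 i| <= K) -> sine_coord_inv (sine_coord x) = x.
Proof.
move=> xK; apply/rowP => i; rewrite !mxE.
have -> : 2 * ((1 + sin (x 0 i / (2 * K))) / 2) - 1 = sin (x 0 i / (2 * K)) by field.
have y1 : - 2^-1 <= x 0 i / (2 * K) <= 2^-1.
  have K2 : 0 < 2 * K by rewrite mulr_gt0.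
  rewrite -ler_norml normrM normfV (gtr0_norm K2) ler_pdivrMr //.
  by rewrite mulrA mulVf // mul1r.
have h := @pihalf_ge1 R.
have inI (y : R) : - 2^-1 <= y <= 2^-1 -> y \in `[(- (pi / 2)), pi / 2].
  by rewrite in_itv /=; lra.
have mono (y z : R) : - 2^-1 <= y <= 2^-1 -> - 2^-1 <= z <= 2^-1 -> y <= z -> sin y <= sin z.
  move=> /inI yI /inI zI; rewrite le_eqVlt => /predU1P[->//|yz].
  by rewrite ltW // ltr_sin.
have s1N : - s1 <= sin (x 0 i / (2 * K)) by rewrite /s1 -sinN; apply: mono => //; lra.
have s1P : sin (x 0 i / (2 * K)) <= s1 by apply: mono => //; lra.
by rewrite max_r // min_r // sinK ?inI // mulrC divfK // mulf_neq0 ?gt_eqF.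
Qed.

Lemma continuous_sine_coord_inv : continuous sine_coord_inv.
Proof.
apply: continuous_row => i u.
pose g (u : 'rV[R]_k) := Num.min s1 (Num.max (- s1) (2 * u 0 i - 1)).
have cg : g v @[v --> u] --> g u.
  apply: (@continuous_min R _ (cst s1) (fun u : 'rV[R]_k => Num.max (- s1) (2 * u 0 i - 1))).
    exact: cst_continuous.
  apply: (@continuous_max R _ (cst (- s1)) (fun u : 'rV[R]_k => 2 * u 0 i - 1)).
    exact: cst_continuous.
  apply: (@cvgB _ _ _ (nbhs u) _ (fun u : 'rV[R]_k => 2 * u 0 i) (cst 1)); last exact: cvg_cst.
  apply: (@cvgM _ _ (nbhs u) _ (cst 2) (fun u : 'rV[R]_k => u 0 i)); first exact: cvg_cst.
  exact: coord_continuous.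
apply: (@cvgM _ _ (nbhs u) _ (cst (2 * K)) (asin \o g)); first exact: cvg_cst.
apply: cvg_comp cg _.
apply: continuous_asin; have := sin1.
rewrite lt_min gt_min lt_max; lra.
Qed.

End SineSubstitution.

Section TrigPolynomials.
Variables (R : realType) (k : nat).
Local Notation V := 'rV[R]_k.
Implicit Types (f g : V -> R) (x t : V).

Definition dot x t : R := \sum_i x 0 i * t 0 i.

(** The phase absorbs sines and constants, so that a single kind of term is
    closed under products. *)
Definition trig_poly g : Prop := exists s : seq (R * V * R),
  forall x, g x = \sum_(c <- s) c.1.1 * cos (dot x c.1.2 + c.2).

Lemma dotDr x t u : dot x (t + u) = dot x t + dot x u.
Proof. by rewrite -big_split; apply: eq_bigr => i _; rewrite mxE mulrDr. Qed.

Lemma dotBr x t u : dot x (t - u) = dot x t - dot x u.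
Proof. by rewrite -sumrB; apply: eq_bigr => i _; rewrite !mxE mulrBr. Qed.

Lemma dot0r x : dot x 0 = 0.
Proof. by apply: big1 => i _; rewrite mxE mulr0. Qed.

Lemma eq_trig_poly f g : f =1 g -> trig_poly f -> trig_poly g.
Proof. by move=> fg [s sE]; exists s => x; rewrite -fg sE. Qed.

Lemma trig_poly_cos t (theta : R) : trig_poly (fun x => cos (dot x t + theta)).
Proof. by exists [:: (1, t, theta)] => x; rewrite big_seq1 mul1r. Qed.

Lemma trig_polyZ (c : R) f : trig_poly f -> trig_poly (fun x => c * f x).
Proof.
move=> [s sE]; exists [seq (c * a.1.1, a.1.2, a.2) | a <- s] => x.
by rewrite sE big_map big_distrr; apply: eq_bigr => a _; rewrite /= mulrA.
Qed.

Lemma trig_poly_cst (c : R) : trig_poly (fun=> c).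
Proof.
apply: eq_trig_poly (trig_polyZ c (trig_poly_cos 0 0)) => x.
by rewrite dot0r addr0 cos0 mulr1.
Qed.

Lemma trig_polyD f g : trig_poly f -> trig_poly g -> trig_poly (fun x => f x + g x).
Proof. by move=> [s sE] [r rE]; exists (s ++ r) => x; rewrite big_cat sE rE. Qed.

Lemma trig_poly_sum (I : Type) (r : seq I) (f : I -> V -> R) :
  (forall i, trig_poly (f i)) -> trig_poly (fun x => \sum_(i <- r) f i x).
Proof.
move=> fP; elim: r => [|i r IH].
  by apply: eq_trig_poly (trig_poly_cst 0) => x; rewrite big_nil.
by apply: eq_trig_poly (trig_polyD (fP i) IH) => x; rewrite big_cons.
Qed.

Lemma trig_polyM f g : trig_poly f -> trig_poly g -> trig_poly (fun x => f x * g x).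
Proof.
move=> [s sE] [r rE].
pose h (a b : R * V * R) x := 2^-1 * a.1.1 * b.1.1 *
  (cos (dot x (a.1.2 + b.1.2) + (a.2 + b.2)) + cos (dot x (a.1.2 - b.1.2) + (a.2 - b.2))).
have hP a b : trig_poly (h a b).
  by apply/trig_polyZ/trig_polyD; exact: trig_poly_cos.
apply: eq_trig_poly (trig_poly_sum s (fun a => trig_poly_sum r (hP a))) => x.
rewrite sE rE big_distrl; apply: eq_bigr => a _; rewrite big_distrr; apply: eq_bigr => b _.
rewrite /h dotDr dotBr.
rewrite (_ : _ + _ + (a.2 + b.2) = (dot x a.1.2 + a.2) + (dot x b.1.2 + b.2)); last by ring.
rewrite (_ : _ - _ + (a.2 - b.2) = (dot x a.1.2 + a.2) - (dot x b.1.2 + b.2)); last by ring.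
by rewrite cosD cosB /=; field.
Qed.

Lemma trig_poly_prod (I : Type) (r : seq I) (f : I -> V -> R) :
  (forall i, trig_poly (f i)) -> trig_poly (fun x => \prod_(i <- r) f i x).
Proof.
move=> fP; elim: r => [|i r IH].
  by apply: eq_trig_poly (trig_poly_cst 1) => x; rewrite big_nil.
by apply: eq_trig_poly (trig_polyM (fP i) IH) => x; rewrite big_cons.
Qed.

Lemma trig_polyX f n : trig_poly f -> trig_poly (fun x => f x ^+ n).
Proof.
move=> fP; elim: n => [|n IH].
  by apply: eq_trig_poly (trig_poly_cst 1) => x; rewrite expr0.
by apply: eq_trig_poly (trig_polyM fP IH) => x; rewrite exprS.
Qed.

Lemma trig_poly_sine_coord K i : trig_poly (fun x => sine_coord K x 0 i).
Proof.
pose t : V := \row_j ((j == i)%:R / (2 * K)).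
apply: (@eq_trig_poly (fun x => 2^-1 * (1 + cos (dot x t + (- (pi / 2)))))).
  move=> x; rewrite cosBpihalf /sine_coord mxE mulrC; congr ((1 + sin _) / 2).
  rewrite /dot (bigD1 i) //= mxE eqxx mul1r big1 ?addr0 // => j /negbTE ji.
  by rewrite mxE ji mul0r mulr0.
by apply/trig_polyZ/trig_polyD; [exact: trig_poly_cst|exact: trig_poly_cos].
Qed.

Lemma trig_poly_tensor_weight K m (a : {ffun 'I_k -> 'I_m.+1}) :
  trig_poly (fun x => tensor_weight a (sine_coord K x)).
Proof.
apply: trig_poly_prod => i; apply: trig_polyM.
  by apply/trig_polyM/trig_polyX/trig_poly_sine_coord; exact: trig_poly_cst.
apply: trig_polyX; apply: (@eq_trig_poly (fun x => 1 + -1 * sine_coord K x 0 i)).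
  by move=> x; rewrite mulN1r.
by apply: trig_polyD; [exact: trig_poly_cst|apply/trig_polyZ/trig_poly_sine_coord].
Qed.

(** Apply Bernstein approximation to [f] in the coordinates
    [(1 + sin (x / 2 K)) / 2]: polynomials in them are trigonometric
    polynomials in [x], they keep the bound [M] on the whole space, and they
    are close to [f] where the coordinates determine [x]. *)
Lemma trig_poly_approx f (M K e : R) : continuous f -> (forall x, `|f x| <= M) ->
  0 < K -> 0 < e ->
  exists g, [/\ trig_poly g, forall x, `|g x| <= M &
    forall x, (forall i, `|x 0 i| <= K) -> `|g x - f x| <= e].
Proof.
move=> cf fM K0 e0.
pose F u := f (sine_coord_inv K u).
have cF : continuous F.
  by move=> u; apply: continuous_comp; [exact: continuous_sine_coord_inv|exact: cf].
have FM u : `|F u| <= M by exact: fM.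
have cptC : compact (@unit_cube R k).
  have := @rV_compact R k (fun=> `[0, 1]%classic) (fun=> @segment_compact R 0 1).
  congr compact; apply/seteqP; split => u h i; have := h i;
    by rewrite /= in_itv.
have e2 : 0 < e / 2 by rewrite divr_gt0.
have [dl dl0 Fdl] := compact_uniform_continuity cptC cF e2.
have M0 : 0 <= M by apply: le_trans (fM 0).
pose c := 2 * M * k%:R / dl ^+ 2.
have c0 : 0 <= c by rewrite !mulr_ge0 ?invr_ge0 ?exprn_ge0 // ltW.
(* By the choice of [m], the Chebyshev term is at most [e / 2]. *)
pose m := (Num.truncn (c / (e / 2))).+1.
have cm : c / m%:R <= e / 2.
  rewrite ler_pdivrMr ?ltr0n // mulrC -ler_pdivrMr //; exact: ltW (truncnS_gt _).
exists (fun x => \sum_(a : {ffun 'I_k -> 'I_m.+1}) F (node R a) * tensor_weight a (sine_coord K x)).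
have cube x := @sine_coord_cube R k K x.
split.
- by apply: trig_poly_sum => a; apply: trig_polyZ; exact: trig_poly_tensor_weight.
- move=> x; apply: le_trans (ler_norm_sum _ _ _) _.
  rewrite -[leRHS]mulr1 -[X in M * X](tensor_weight_sum1 m (sine_coord K x)) big_distrr /=.
  apply: ler_sum => a _; rewrite normrM (ger0_norm (tensor_weight_ge0 a (cube x))).
  by rewrite ler_wpM2r ?tensor_weight_ge0.
- move=> x xK; rewrite -[f x](_ : F (sine_coord K x) = _); last by rewrite /F sine_coordK.
  have h := @tensor_bernstein_approx R k m isT F M (e / 2) dl (sine_coord K x) dl0 FM (cube x).
  apply: le_trans (h _ (ltW e2)) _.
    by move=> v cv vu; apply/ltW/Fdl.
  by rewrite -/c; lra.
Qed.

End TrigPolynomials.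

(** * From characteristic functions to bounded continuous functions *)

Section ConvergenceCriterion.
Variables (R : realType) (k : nat).
Local Notation V := 'rV[R]_k.
Variables (d : measure_display) (T : measurableType d) (P : probability T R) (L : T -> V).
Hypothesis mL : forall i, measurable_fun setT (fun w => L w 0 i).
Variable ell : V -> R -> R.
Hypothesis cfL : forall t theta,
  (\int[P]_w (cos (dot (L w) t + theta))%:E = (ell t theta)%:E)%E.

Lemma measurable_dot t : measurable_fun setT (fun w => dot (L w) t).
Proof. by apply: measurable_sum => i; apply: measurable_funM. Qed.

Lemma measurable_cos_dot t theta : measurable_fun setT (fun w => cos (dot (L w) t + theta)).
Proof.
apply: (@measurableT_comp _ _ _ _ _ _ cos).
  by apply: continuous_measurable_fun; exact: continuous_cos.
by apply: measurable_funD => //; exact: measurable_dot.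
Qed.

Lemma measurable_trig_poly g : trig_poly g -> measurable_fun setT (g \o L).
Proof.
move=> [s sE]; rewrite (_ : g \o L = fun w => \sum_(c <- s) c.1.1 * cos (dot (L w) c.1.2 + c.2)).
  apply: measurable_sum => c; apply: measurable_funM => //; exact: measurable_cos_dot.
by apply/funext => w /=; rewrite sE.
Qed.

Lemma integrable_bounded (h : T -> R) (M : R) : measurable_fun setT h ->
  (forall w, `|h w| <= M) -> P.-integrable setT (EFin \o h).
Proof.
move=> mh hM; apply: (@measurable_bounded_integrable _ _ _ P) => //.
- by rewrite /= probability_setT ltry.
- by exists M; split; [rewrite num_real|move=> x Mx w _; exact: le_trans (hM w) (ltW Mx)].
Qed.

Variables (U : nat -> finType) (q : forall n, U n -> R) (Vn : forall n, U n -> V) (C : R).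
Hypothesis q_ge0 : forall n u, 0 <= @q n u.
Hypothesis q_sum1 : forall n, \sum_u @q n u = 1.
Hypothesis tight : forall n i, (0 < n)%N -> \sum_u @q n u * (Vn u 0 i) ^+ 2 <= C.
Hypothesis cfn : forall t theta,
  \sum_u @q n u * cos (dot (Vn u) t + theta) @[n --> \oo] --> ell t theta.

Lemma cvg_trig_poly g : trig_poly g ->
  \sum_u @q n u * g (Vn u) @[n --> \oo] --> fine (\int[P]_w (g (L w))%:E)%E.
Proof.
move=> [s sE].
have -> : fine (\int[P]_w (g (L w))%:E)%E = \sum_(c <- s) c.1.1 * ell c.1.2 c.2.
  transitivity (fine (\int[P]_w (\sum_(c <- s) (c.1.1 * cos (dot (L w) c.1.2 + c.2))%:E))%E).
    by congr fine; apply: eq_integral => w _; rewrite sE sumEFin.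
  have ic c : P.-integrable setT (fun w => (c.1.1 * cos (dot (L w) c.1.2 + c.2))%:E).
    under eq_fun do rewrite EFinM.
    apply: integrableZl => //; apply: integrable_bounded (measurable_cos_dot _ _) _ => w.
    exact: cos_max.
  rewrite integral_sum //.
  rewrite (eq_bigr (fun c => (c.1.1 * ell c.1.2 c.2)%:E)) ?sumEFin // => c _.
  under eq_integral do rewrite EFinM.
  rewrite integralZl //; first by rewrite cfL.
  apply: integrable_bounded (measurable_cos_dot _ _) _ => w; exact: cos_max.
rewrite (_ : (fun n => _) = fun n =>
  \sum_(c <- s) c.1.1 * \sum_u @q n u * cos (dot (Vn u) c.1.2 + c.2)).
  apply: cvg_big => [|c _]; first exact: add_continuous.
  by apply: cvgM; [exact: cvg_cst|exact: cfn].
apply/funext => n; under eq_bigr do rewrite sE big_distrr /=.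
rewrite exchange_big; apply: eq_bigr => c _; rewrite big_distrr; apply: eq_bigr => u _ /=.
by rewrite mulrCA.
Qed.

(** Let [g m] approximate [f] within [1/(m+1)] on the cube of radius [m+1].
    Under the limit law, [g m] tends to [f] boundedly; this also gives the
    measurability of [f] along [L]. Under the approximating laws, the second
    moments bound the mass outside the cube by [k C / (m+1)], uniformly in
    [n]. *)
Theorem cvg_bounded_continuous f : continuous f -> (exists M, forall v, `|f v| <= M) ->
  ((\sum_u @q n u * f (Vn u))%:E @[n --> \oo] --> 'E_P[fun w => f (L w)])%E.
Proof.
move=> cf [M fM].
have M0 : 0 <= M by apply: le_trans (fM 0).
have ex m : exists g, [/\ trig_poly g, forall x, `|g x| <= M &
    forall x : V, (forall i, `|x 0 i| <= m.+1%:R) -> `|g x - f x| <= m.+1%:R^-1].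
  by apply: trig_poly_approx => //; rewrite ?invr_gt0 ltr0Sn.
pose g m := sval (cid (ex m)).
have gP m : [/\ trig_poly (g m), forall x, `|g m x| <= M &
    forall x : V, (forall i, `|x 0 i| <= m.+1%:R) -> `|g m x - f x| <= m.+1%:R^-1].
  by rewrite /g; case: cid.
have gf x : g m x @[m --> \oo] --> f x.
  apply/cvgrPdist_le => e e0.
  have := @cvg_harmonic R; move/cvgrPdist_le => /(_ _ e0) he.
  near=> m; rewrite distrC; have [_ _ /(_ x) h] := gP m; apply: le_trans (h _) _.
    move=> i; apply: (@le_trans _ _ (\sum_i `|x 0 i|)).
      by rewrite (bigD1 i) //= lerDl sumr_ge0.
    near: m; exists (Num.truncn (\sum_i `|x 0 i|)) => // m /= mx.
    by apply: le_trans (ltW (truncnS_gt _)) _; rewrite ler_nat.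
  have : `|0 - harmonic m : R| <= e by near: m.
  by rewrite sub0r normrN; apply: le_trans; exact: ler_norm.
have mg m : measurable_fun setT (g m \o L) by apply: measurable_trig_poly; case: (gP m).
have mf : measurable_fun setT (f \o L).
  by apply: (measurable_fun_cvg mg) => w _; exact: gf.
have int_f : P.-integrable setT (EFin \o (f \o L)).
  by apply: integrable_bounded mf _ => w; exact: fM.
pose I := fine (\int[P]_w (f (L w))%:E)%E.
pose J m := fine (\int[P]_w (g m (L w))%:E)%E.
have JI : J m @[m --> \oo] --> I.
  apply: fine_cvg; rewrite /I fineK; last exact: integrable_fin_num int_f.
  apply: (@dominated_cvg _ _ _ P setT _ (fun m w => (g m (L w))%:E) _ (fun=> M%:E)) => //.
  - by move=> m; apply/measurable_EFinP; exact: mg.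
  - by move=> w _; apply: cvg_EFin; [exact: nearW|exact: gf].
  - by have := @integrable_bounded (fun=> M) M; apply => // _; rewrite ger0_norm.
  - by move=> m w _; rewrite lee_fin; case: (gP m) => _ /(_ (L w)).
have -> : ('E_P[fun w => f (L w)] = I%:E)%E.
  by rewrite unlock /I fineK //; exact: integrable_fin_num int_f.
apply: cvg_EFin; first exact: nearW.
pose B := 1 + 2 * M * k%:R * C.
have gap m n : (0 < n)%N ->
    `|\sum_u @q n u * g m (Vn u) - \sum_u @q n u * f (Vn u)| <= B * m.+1%:R^-1.
  move=> n0; have [_ gM gmf] := gP m.
  have pt x : `|g m x - f x| <= m.+1%:R^-1 + 2 * M * m.+1%:R^-1 * \sum_i x 0 i ^+ 2.
    have s0 : 0 <= \sum_i x 0 i ^+ 2 by apply: sumr_ge0 => i _; exact: sqr_ge0.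
    have [h|/forallPn[i]] := boolP [forall i, `|x 0 i| <= m.+1%:R].
      by rewrite (le_trans (gmf _ (fun i => forallP h i))) // lerDl !mulr_ge0.
    (* Outside the cube both functions are bounded by [M], and the sum of the
       squared coordinates is at least [m + 1]. *)
    rewrite -ltNge => mi; apply: le_trans (ler_normB _ _) _.
    apply: le_trans (lerD (gM _) (fM _)) _.
    have xi : m.+1%:R <= \sum_i x 0 i ^+ 2.
      apply: (@le_trans _ _ (x 0 i ^+ 2)); last first.
        by rewrite (bigD1 i) //= lerDl; apply: sumr_ge0 => j _; exact: sqr_ge0.
      have m1 : 1 <= m.+1%:R :> R by rewrite ler1n.
      by rewrite -real_normK ?num_real //; nra.
    rewrite -mulrA (_ : M + M = 2 * M * 1); last by ring.
    rewrite (@le_trans _ _ (2 * M * (m.+1%:R^-1 * \sum_i x 0 i ^+ 2))) ?lerDr //.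
    by rewrite ler_wpM2l ?mulr_ge0 // mulrC ler_pdivlMr ?ltr0n // mul1r.
  rewrite -sumrB; apply: le_trans (ler_norm_sum _ _ _) _.
  apply: (@le_trans _ _ (\sum_u @q n u * (m.+1%:R^-1 + 2 * M * m.+1%:R^-1 * \sum_i Vn u 0 i ^+ 2))).
    apply: ler_sum => u _; rewrite -mulrBr normrM ger0_norm //.
    by rewrite ler_wpM2l.
  under eq_bigr do rewrite mulrDr; rewrite big_split /= -mulr_suml q_sum1 mul1r.
  under eq_bigr do rewrite mulrCA; rewrite -big_distrr /=.
  under eq_bigr do rewrite big_distrr /=; rewrite exchange_big /=.
  have h : \sum_i \sum_u @q n u * Vn u 0 i ^+ 2 <= k%:R * C.
    apply: le_trans (ler_sum _ (fun i _ => tight i n0)) _.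
    by rewrite sumr_const card_ord mulr_natl.
  have : 2 * M * m.+1%:R^-1 * (\sum_i \sum_u @q n u * Vn u 0 i ^+ 2) <=
      2 * M * m.+1%:R^-1 * (k%:R * C).
    by rewrite ler_wpM2l // !mulr_ge0.
  rewrite (_ : B * m.+1%:R^-1 = m.+1%:R^-1 + 2 * M * m.+1%:R^-1 * (k%:R * C)).
    by rewrite lerD2l.
  by rewrite /B; ring.
apply/cvgrPdist_le => e e0.
have e3 : 0 < e / 3 by rewrite divr_gt0.
have Bh : B * m.+1%:R^-1 @[m --> \oo] --> (0 : R).
  rewrite [X in _ --> X](_ : 0 = B * 0); last by rewrite mulr0.
  by apply: cvgM; [exact: cvg_cst|exact: cvg_harmonic].
near \oo => m.
have Jm : `|I - J m| <= e / 3 by near: m; move/cvgrPdist_le : JI => /(_ _ e3).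
have Bm : `|0 - B * m.+1%:R^-1| <= e / 3 by near: m; move/cvgrPdist_le : Bh => /(_ _ e3).
have [gm _ _] := gP m; have /cvgrPdist_le/(_ _ e3) Jn := cvg_trig_poly gm.
near=> n.
have n0 : (0 < n)%N by near: n; exists 1%N.
have Jmn : `|J m - \sum_u @q n u * g m (Vn u)| <= e / 3 by near: n.
rewrite /= (_ : e = e / 3 + (e / 3 + e / 3)); last by field.
apply: le_trans (ler_distD (J m) _ _) _; apply: lerD => //.
apply: le_trans (ler_distD (\sum_u @q n u * g m (Vn u)) _ _) _; apply: lerD => //.
by apply: le_trans (gap m n n0) (le_trans _ Bm); rewrite sub0r normrN ler_norm.
Unshelve. all: by end_near. Qed.

End ConvergenceCriterion.

(** * Conditional distributions and samples from a finite law *)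

Section ConditionalDistribution.
Context (R : realType) (d : measure_display) (Om : measurableType d).
Variable P : probability Om R.

(** The event where one version is strictly smaller than the other is in the
    conditioning sigma-algebra, so both versions have the same integral on
    it. *)
Lemma cond_dist_unique (G : set (set Om)) (U : finType) (V : Om -> U) (q1 q2 : Om -> U -> R) :
  (forall A, G A -> measurable A) -> cond_dist P G V q1 -> cond_dist P G V q2 ->
  {ae P, forall w, forall u, q1 w u = q2 w u}.
Proof.
move=> Gm.
have sGm A : <<s G >> A -> measurable A.
  by apply: smallest_sub => //; exact: sigma_algebra_measurable.
suff half (r1 r2 : Om -> U -> R) : cond_dist P G V r1 -> cond_dist P G V r2 ->
    forall u, P.-negligible [set w | r1 w u < r2 w u].
  move=> c1 c2.
  have : P.-negligible (\big[setU/set0]_(u <- enum U)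
      ([set w | q1 w u < q2 w u] `|` [set w | q2 w u < q1 w u])).
    elim: (enum U) => [|u s IH]; first by rewrite big_nil; exact: negligible_set0.
    by rewrite big_cons; apply: negligibleU => //; apply: negligibleU; exact: half.
  apply: negligibleS => w /= nq.
  have [u qu] : exists u, q1 w u <> q2 w u by apply/existsNP.
  rewrite -bigcup_seq; exists u; first by rewrite /= mem_enum.
  by move/eqP : qu; rewrite neq_lt => /orP[]; [left|right].
move=> [r1_0 r1_1 r1_m r1_P] [r2_0 r2_1 r2_m r2_P] u.
have r_le (r : Om -> U -> R) : (forall w v, 0 <= r w v) -> (forall w, \sum_v r w v = 1) ->
    forall w, `|r w u| <= 1.
  by move=> r0 rs w; rewrite ger0_norm // -(rs w) (bigD1 u) //= lerDl sumr_ge0.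
pose A := [set w | r1 w u < r2 w u].
have mG (r : Om -> U -> R) : (forall v (B : set R), measurable B -> <<s G >> [set w | B (r w v)]) ->
    @measurable_fun _ _ (g_sigma_algebraType G) R setT (fun w => r w u).
  by move=> rm _ B mB; rewrite setTI; exact: rm.
have GA : <<s G >> A.
  have := @measurable_funB _ _ _ _ _ _ (mG r2 r2_m) (mG r1 r1_m).
  move=> /(_ measurableT `]0, +oo[%classic (measurable_itv _)).
  rewrite setTI; congr (<<s G >> _); apply/seteqP; split => w /=;
    by rewrite in_itv /= andbT subr_gt0.
have mA := sGm _ GA.
have mr (r : Om -> U -> R) : (forall v (B : set R), measurable B -> <<s G >> [set w | B (r w v)]) ->
    measurable_fun setT (fun w => r w u).
  by move=> rm _ B mB; rewrite setTI; apply: sGm; exact: rm.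
have ir (r : Om -> U -> R) : (forall w v, 0 <= r w v) -> (forall w, \sum_v r w v = 1) ->
    (forall v (B : set R), measurable B -> <<s G >> [set w | B (r w v)]) ->
    P.-integrable A (fun w => (r w u)%:E).
  move=> r0 rs rm; apply: (integrableS measurableT) => //.
  by apply: integrable_bounded (mr r rm) _ => w; exact: r_le.
have i1 := ir r1 r1_0 r1_1 r1_m; have i2 := ir r2 r2_0 r2_1 r2_m.
have mD : measurable_fun A (fun w => (r2 w u - r1 w u)%:E).
  apply/measurable_EFinP; apply: measurable_funTS; apply: measurable_funB; exact: mr.
have : (\int[P]_(w in A) `|(r2 w u - r1 w u)%:E| = 0)%E.
  transitivity (\int[P]_(w in A) ((r2 w u)%:E - (r1 w u)%:E))%E.
    apply: eq_integral => w; rewrite inE /A /= => rw.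
    by rewrite ger0_norm ?subr_ge0 ?(ltW rw) // EFinB.
  by rewrite integralB // -r2_P // r1_P // subee // integrable_fin_num.
move/(ae_eq_integral_abs P mA mD).1; apply: negligibleS => w /= rw /(_ rw) [].
by move/eqP; rewrite subr_eq0 => /eqP h; move: rw; rewrite h ltxx.
Qed.

End ConditionalDistribution.

Section FiniteSample.
Context (R : realType) (d : measure_display) (Om : measurableType d).
Variables (P : probability Om R) (T : finType) (pr : T -> R) (W : nat -> Om -> T).
Hypothesis W_rv : forall i, finite_rv (W i).
Hypothesis W_law : forall i t, P (W i @^-1` [set t]) = (pr t)%:E.
Hypothesis W_ind : mutually_independent P W.

Lemma measurable_preimage_finite i (B : set T) : measurable (W i @^-1` B).
Proof.
rewrite (_ : W i @^-1` B = \bigcup_(t in B) (W i @^-1` [set t])).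
  apply: fin_bigcup_measurable; first exact: finite_finset.
  by move=> t _; exact: W_rv.
by apply/seteqP; split => [w Bw|w [t Bt /= ->] //]; exists (W i w).
Qed.

Lemma measurable_seq_events A : seq_events W A -> measurable A.
Proof. by move=> [i [B ->]]; exact: measurable_preimage_finite. Qed.

Lemma sigma_seq_events_measurable A : <<s seq_events W >> A -> measurable A.
Proof.
apply: smallest_sub; first exact: sigma_algebra_measurable.
exact: measurable_seq_events.
Qed.

Definition sample_event n (D : 'I_n -> T) : set Om := [set w | forall i : 'I_n, W i w = D i].

Let ext n (D : 'I_n -> T) (i : nat) : set T :=
  [set t | if insub i is Some j then t = D j else True].

Let sample_eventE n (D : 'I_n -> T) :
  sample_event D = \bigcap_(i in [set` iota 0 n]) W i @^-1` ext D i.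
Proof.
apply/seteqP; split => [w h i /=|w h i].
  rewrite mem_iota /= add0n => ilt; rewrite /ext /= insubT; exact: (h (Ordinal ilt)).
have /= := h i; rewrite mem_iota /= add0n ltn_ord => /(_ isT).
by rewrite /ext /= valK.
Qed.

Lemma sample_event_sigma n (D : 'I_n -> T) : <<s seq_events W >> (sample_event D).
Proof.
rewrite sample_eventE.
suff : @measurable _ (g_sigma_algebraType (seq_events W))
  (\bigcap_(i in [set` iota 0 n]) W i @^-1` ext D i) by [].
apply: fin_bigcap_measurable => // i _; apply: sub_sigma_algebra.
by exists i, (ext D i).
Qed.

Lemma measurable_sample_event n (D : 'I_n -> T) : measurable (sample_event D).
Proof. exact: sigma_seq_events_measurable (sample_event_sigma D). Qed.

Lemma prob_sample_event n (D : 'I_n -> T) : P (sample_event D) = (\prod_i pr (D i))%:E.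
Proof.
rewrite sample_eventE W_ind ?iota_uniq //.
rewrite -prodEFin -[in iota 0 n](subn0 n) -/(index_iota 0 n) big_mkord.
apply: eq_bigr => i _; rewrite -(W_law i); congr (P _); apply/seteqP.
by split => w; rewrite /ext /= valK.
Qed.

Definition sample_sum n (h : T -> R) w : R := \sum_(i < n) h (W i w).

Lemma measure_bigsetU_le (I : Type) (s : seq I) (F : I -> set Om) :
  (forall i, measurable (F i)) ->
  (P (\big[setU/set0]_(i <- s) F i) <= \sum_(i <- s) P (F i))%E.
Proof.
move=> mF; elim: s => [|i s IH]; first by rewrite !big_nil measure0.
rewrite !big_cons; apply: le_trans (measureU2 _ _ _) _ => //.
  exact: bigsetU_measurable.
exact: leeD2l.
Qed.

Let nonneg_samples n (h : T -> R) :=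
  [seq D : {ffun 'I_n -> T} <- enum {: {ffun 'I_n -> T}} | 0 <= \sum_i h (D i)].

Lemma sample_sum_eventE n (h : T -> R) : [set w | 0 <= sample_sum n h w] =
  \big[setU/set0]_(D <- nonneg_samples n h) sample_event D.
Proof.
rewrite -bigcup_seq; apply/seteqP; split => [w h0|w [D /=]].
  exists [ffun i => W (val i) w]; last by move=> i; rewrite ffunE.
  rewrite /= mem_filter mem_enum andbT; move: h0; rewrite /= /sample_sum.
  by under [X in _ -> is_true (_ <= X)]eq_bigr do rewrite ffunE.
rewrite mem_filter => /andP[+ _] wD; rewrite /sample_sum.
by under [X in _ -> is_true (_ <= X)]eq_bigr do rewrite wD.
Qed.

Lemma measurable_sample_sum_event n (h : T -> R) : measurable [set w | 0 <= sample_sum n h w].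
Proof.
rewrite sample_sum_eventE; apply: bigsetU_measurable => D _; exact: measurable_sample_event.
Qed.

Lemma pr_ge0 t : 0 <= pr t.
Proof. by rewrite -lee_fin -(W_law 0 t) measure_ge0. Qed.

(** Bound the indicator of [0 <= h x_1 + ... + h x_n] by
    [exp (lambda (h x_1 + ... + h x_n))]; the expectation factorises. *)
Lemma chernoff_bound n (h : T -> R) (lambda : R) : 0 <= lambda ->
  (P [set w | (0 <= sample_sum n h w)%R] <=
     ((\sum_t pr t * expR (lambda * h t)) ^+ n)%:E)%E.
Proof.
move=> l0; rewrite sample_sum_eventE.
apply: le_trans (measure_bigsetU_le _ _) _; first by move=> D; exact: measurable_sample_event.
under eq_bigr do rewrite prob_sample_event.
rewrite sumEFin lee_fin big_filter big_enum_cond /=.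
rewrite -[leRHS](_ : \prod_(i < n) \sum_t pr t * expR (lambda * h t) = _); last first.
  by rewrite prodr_const card_ord.
rewrite bigA_distr_bigA [leRHS](bigID (fun D : {ffun 'I_n -> T} => 0 <= \sum_i h (D i))) /=.
apply: le_trans (_ : \sum_(D : {ffun 'I_n -> T} | 0 <= \sum_i h (D i))
   \prod_i (pr (D i) * expR (lambda * h (D i))) <= _); last first.
  rewrite lerDl; apply: sumr_ge0 => D _; apply: prodr_ge0 => i _.
  by rewrite mulr_ge0 ?pr_ge0 ?expR_ge0.
apply: ler_sum => D D0; rewrite big_split /= -expR_sum -big_distrr /=.
rewrite ler_peMr ?prodr_ge0 // => [i _|]; first exact: pr_ge0.
by rewrite -[leLHS]expR0 ler_expR mulr_ge0.
Qed.

Hypothesis pr_sum1 : \sum_t pr t = 1.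

(** The moment generating function equals [1] at [0] and has there the
    negative derivative [E h]. *)
Lemma exists_chernoff_rate (h : T -> R) : \sum_t pr t * h t < 0 ->
  exists2 lambda, 0 <= lambda & \sum_t pr t * expR (lambda * h t) < 1.
Proof.
move=> h0.
pose f x := \sum_t pr t * expR (x * h t).
pose df x := \sum_t pr t * (h t * expR (x * h t)).
have dfP (x : R) : is_derive x (1 : R) f (df x).
  apply: is_derive_fsum => t.
  have h1 : is_derive x (1 : R) (fun x : R => x * h t) (h t).
    by apply: is_derive_eq; rewrite ?scaler0 ?addr0 ?add0r /GRing.scale /= mulr1.
  have h2 := @is_derive1_comp _ expR (fun x : R => x * h t) x _ _ (is_derive_expR _) h1.
  have h3 : is_derive x (1 : R) (fun x => expR (x * h t)) (h t * expR (x * h t)).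
    by apply: is_derive_eq h2 _; rewrite mulrC.
  by apply: is_derive_eq; rewrite ?scaler0 ?addr0 ?add0r /GRing.scale.
have cdf : df x @[x --> (0 : R)] --> df 0.
  rewrite /df; apply: cvg_big => [|t _]; first exact: add_continuous.
  apply: cvgM; first exact: cvg_cst; apply: cvgM; first exact: cvg_cst.
  apply: (@cvg_comp _ _ _ (fun x : R => x * h t) expR _ (nbhs (0 * h t))).
    by apply: cvgM; [exact: cvg_id|exact: cvg_cst].
  exact: continuous_expR.
have df0 : df 0 < 0.
  by rewrite /df; under eq_bigr do rewrite mul0r expR0 mulr1.
have /nbhs_ballP[e /= e0 eP] : \forall x \near (0 : R), df x < 0 by apply: cvgr_lt cdf _ df0.
have f0 : f 0 = 1 by rewrite /f; under eq_bigr do rewrite mul0r expR0 mulr1.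
exists (e / 2); first by rewrite divr_ge0 // ltW.
have [z ze fE] := mean_value 0 (e / 2) dfP.
suff : f (e / 2) - f 0 < 0 by rewrite f0 subr_lt0.
rewrite fE subr0 nmulr_rlt0 ?divr_gt0 //.
apply: eP; rewrite /ball /= sub0r normrN; move: ze; rewrite !subr0 => /le_lt_trans; apply.
by rewrite ger0_norm ?divr_ge0 ?ltW // ltr_pdivrMr // ltr_pMr // ltr1n.
Qed.

(** The Chernoff bounds are summable; conclude by the Borel-Cantelli lemma. *)
Lemma sample_sum_eventually_neg (h : T -> R) : \sum_t pr t * h t < 0 ->
  {ae P, forall w, \forall n \near \oo, sample_sum n h w < 0}.
Proof.
move=> /exists_chernoff_rate[lambda l0]; set rho := \sum_t _ => rho1.
pose F n := [set w | 0 <= sample_sum n h w].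
have rho0 : 0 <= rho by apply: sumr_ge0 => t _; rewrite mulr_ge0 ?pr_ge0 ?expR_ge0.
have Foo : (\sum_(n <oo) P (F n) < +oo)%E.
  apply: (@le_lt_trans _ _ ((1 - rho)^-1)%:E); last exact: ltry.
  apply: lime_le; first exact: is_cvg_nneseries.
  apply: nearW => n; apply: (@le_trans _ _ (\sum_(0 <= k < n) (rho ^+ k)%:E)%E).
    by apply: lee_sum => k _; exact: chernoff_bound.
  rewrite sumEFin lee_fin big_mkord.
  have := subrX1 rho n; set S := \sum_(i < n) _ => e.
  rewrite -[leRHS]mul1r ler_pdivlMr ?subr_gt0 //.
  have := exprn_ge0 n rho0; lra.
have := lim_sup_set_cvg0 (measurable_sample_sum_event^~ h) Foo.
move=> F0; exists (lim_sup_set F); split => //.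
  apply: bigcap_measurable => // k _; apply: bigcup_measurable => j _.
  exact: measurable_sample_sum_event.
move=> w /= nw n _; apply: contrapT => nF; apply: nw; exists n => // j /= nj.
rewrite ltNge; apply/negP => Fj; apply: nF; by exists j.
Qed.

(** The sums of [+-(g - mu) - 1/(m+1)] are eventually negative, for every
    [m]. *)
Theorem strong_law (g : T -> R) :
  {ae P, forall w, sample_sum n g w / n%:R @[n --> \oo] --> \sum_t pr t * g t}.
Proof.
set mu := \sum_t _.
pose h (b : bool) (m : nat) t := (-1) ^+ b * (g t - mu) - m.+1%:R^-1.
have hneg b m : \sum_t pr t * h b m t < 0.
  rewrite (_ : \sum_t _ = - m.+1%:R^-1) ?oppr_lt0 ?invr_gt0 //.
  transitivity ((-1) ^+ b * (mu - mu * \sum_t pr t) - m.+1%:R^-1 * \sum_t pr t).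
    rewrite !big_distrr /= -sumrB big_distrr -sumrB; apply: eq_bigr => t _ /=.
    by rewrite /h; ring.
  by rewrite pr_sum1; ring.
have : {ae P, forall w, forall m, (\forall n \near \oo, sample_sum n (h false m) w < 0) /\
    (\forall n \near \oo, sample_sum n (h true m) w < 0)}.
  apply/ae_foralln => m; have h1 := sample_sum_eventually_neg (hneg false m).
  have h2 := sample_sum_eventually_neg (hneg true m).
  by apply: filterS2 h1 h2 => w.
apply: filterS => w hw; apply/cvgrPdist_lt => e e0.
have he : \forall m \near \oo, `|0 - harmonic m : R| < e.
  by have := @cvg_harmonic R; move/cvgrPdist_lt; apply.
near \oo => m.
have me : m.+1%:R^-1 < e.
  have hm : `|0 - harmonic m : R| < e by near: m.
  by move: hm; rewrite sub0r normrN ger0_norm ?harmonic_ge0.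
have [h1 h2] := hw m; near=> n.
have n0 : 0 < n%:R :> R by rewrite ltr0n; near: n; exists 1%N.
have sE b : sample_sum n (h b m) w = (-1) ^+ b * (sample_sum n g w - n%:R * mu) - n%:R / m.+1%:R.
  rewrite /sample_sum /h sumrB -big_distrr sumrB /= !sumr_const card_ord.
  by rewrite -[mu *+ n]mulr_natl -[m.+1%:R^-1 *+ n]mulr_natl.
have : sample_sum n (h false m) w < 0 by near: n.
have : sample_sum n (h true m) w < 0 by near: n.
rewrite !sE expr0 expr1 mul1r mulN1r distrC => s1 s2.
apply: le_lt_trans me; rewrite (_ : _ - mu = (sample_sum n g w - n%:R * mu) / n%:R); last first.
  by field; rewrite gt_eqF.
rewrite normrM normfV (gtr0_norm n0) ler_pdivrMr // [leRHS]mulrC ler_norml.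
by move: s1 s2; rewrite !subr_lt0 lerNl => /ltW -> /ltW ->.
Unshelve. all: by end_near. Qed.
End FiniteSample.

(** * The limiting covariance *)

Section Covariance.
Variable R : realType.

(** The second difference changes sign when [x] and [x'], or [y] and [y'], are
    exchanged. Hence the four terms of its expansion against itself contribute
    equally, and the left-hand side is the mean of [t x y] times the second
    difference. *)
Lemma double_centring (X Y : finType) (a : X -> R) (b : Y -> R) (t : X -> Y -> R) :
  \sum_x a x = 1 -> \sum_y b y = 1 ->
  4^-1 * (\sum_x \sum_y \sum_x' \sum_y' a x * b y * (a x' * b y') *
     (t x y + t x' y' - t x' y - t x y') ^+ 2) =
  \sum_x \sum_y \sum_x' \sum_y' t x y * t x' y' *
    (a x * b y * a x' * b y' - (x == x')%:R * a x * b y * b y'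
     - (y == y')%:R * a x * a x' * b y + ((x == x') && (y == y'))%:R * a x * b y).
Proof.
move=> a1 b1.
pose E4 (F : X -> Y -> X -> Y -> R) :=
  \sum_x \sum_y \sum_x' \sum_y' a x * b y * (a x' * b y') * F x y x' y'.
pose dt x y x' y' := t x y + t x' y' - t x' y - t x y'.
have E4D F G : E4 (fun x y x' y' => F x y x' y' + G x y x' y') = E4 F + E4 G.
  rewrite /E4 -big_split; apply: eq_bigr => x _; rewrite -big_split; apply: eq_bigr => y _.
  rewrite -big_split; apply: eq_bigr => x' _; rewrite -big_split; apply: eq_bigr => y' _ /=.
  by rewrite mulrDr.
have E4N F : E4 (fun x y x' y' => - F x y x' y') = - E4 F.
  rewrite /E4 -sumrN; apply: eq_bigr => x _; rewrite -sumrN; apply: eq_bigr => y _.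
  rewrite -sumrN; apply: eq_bigr => x' _; rewrite -sumrN; apply: eq_bigr => y' _.
  by rewrite mulrN.
have E4_eq F G : (forall x y x' y', F x y x' y' = G x y x' y') -> E4 F = E4 G.
  move=> FG; apply: eq_bigr => x _; apply: eq_bigr => y _; apply: eq_bigr => x' _.
  by apply: eq_bigr => y' _; rewrite FG.
have E4_swapx F : E4 F = E4 (fun x y x' y' => F x' y x y').
  rewrite /E4 exchange_big /= [RHS]exchange_big /=; apply: eq_bigr => y _.
  rewrite exchange_big /=; apply: eq_bigr => x _; apply: eq_bigr => x' _.
  by apply: eq_bigr => y' _; ring.
have E4_swapy F : E4 F = E4 (fun x y x' y' => F x y' x' y).
  apply: eq_bigr => x _; rewrite exchange_big /= [RHS]exchange_big /=; apply: eq_bigr => x' _.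
  rewrite exchange_big /=; apply: eq_bigr => y _; apply: eq_bigr => y' _; ring.
pose Q := E4 (fun x y x' y' => dt x y x' y' * t x y).
have -> : \sum_x \sum_y \sum_x' \sum_y' a x * b y * (a x' * b y') *
     (t x y + t x' y' - t x' y - t x y') ^+ 2 = 4 * Q.
  transitivity (E4 (fun x y x' y' => (dt x y x' y' * t x y + dt x y x' y' * t x' y')
     + - (dt x y x' y' * t x' y + dt x y x' y' * t x y'))).
    by apply: E4_eq => x y x' y'; rewrite /dt; ring.
  rewrite !(E4D, E4N).
  have -> : E4 (fun x y x' y' => dt x y x' y' * t x' y') = Q.
    by rewrite E4_swapx E4_swapy; apply: E4_eq => x y x' y'; rewrite /dt; ring.
  have -> : E4 (fun x y x' y' => dt x y x' y' * t x' y) = - Q.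
    by rewrite E4_swapx /Q -E4N; apply: E4_eq => x y x' y'; rewrite /dt; ring.
  have -> : E4 (fun x y x' y' => dt x y x' y' * t x y') = - Q.
    by rewrite E4_swapy /Q -E4N; apply: E4_eq => x y x' y'; rewrite /dt; ring.
  by rewrite -/Q; ring.
rewrite mulrA mulVf ?pnatr_eq0 // mul1r; apply: eq_bigr => x _; apply: eq_bigr => y _.
pose c := a x * b y * t x y.
have sumD (F G : X -> Y -> R) : \sum_x' \sum_y' (F x' y' + G x' y') =
    (\sum_x' \sum_y' F x' y') + \sum_x' \sum_y' G x' y'.
  by rewrite -big_split; apply: eq_bigr => x' _; rewrite big_split.
have sumN (F : X -> Y -> R) : \sum_x' \sum_y' - F x' y' = - \sum_x' \sum_y' F x' y'.
  by rewrite -sumrN; apply: eq_bigr => x' _; rewrite sumrN.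
have sumZ (F : X -> Y -> R) k : \sum_x' \sum_y' k * F x' y' = k * \sum_x' \sum_y' F x' y'.
  by rewrite big_distrr; apply: eq_bigr => x' _; rewrite big_distrr.
pose m := \sum_x' \sum_y' a x' * b y' * t x' y'.
pose r := \sum_x' a x' * t x' y.
pose l := \sum_y' b y' * t x y'.
transitivity (c * (m + t x y - r - l)).
  transitivity (c * \sum_x' \sum_y' (((a x' * b y' * t x' y' + a x' * b y' * t x y)
      + - (a x' * b y' * t x' y)) + - (a x' * b y' * t x y'))).
    rewrite -sumZ; apply: eq_bigr => x' _; apply: eq_bigr => y' _.
    by rewrite /c /dt; ring.
  rewrite !(sumD, sumN); congr (_ * (_ + _ - _ - _)).
  - under eq_bigr do rewrite -mulr_suml -big_distrr b1 /= mulr1.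
    by rewrite -mulr_suml a1 mul1r.
  - by apply: eq_bigr => x' _; rewrite -mulr_suml -big_distrr b1 /= mulr1.
  - rewrite exchange_big /=; apply: eq_bigr => y' _.
    by rewrite -2!mulr_suml a1 mul1r.
have deltaX (F : X -> Y -> R) : \sum_x' \sum_y' (x == x')%:R * F x' y' = \sum_y' F x y'.
  rewrite (bigD1 x) //= eqxx [X in _ + X]big1 ?addr0; first by apply: eq_bigr => y' _; rewrite mul1r.
  by move=> x'; rewrite eq_sym => /negbTE ->; apply: big1 => y' _; rewrite mul0r.
have deltaY (F : X -> Y -> R) : \sum_x' \sum_y' (y == y')%:R * F x' y' = \sum_x' F x' y.
  apply: eq_bigr => x' _; rewrite (bigD1 y) //= eqxx big1 ?addr0 ?mul1r // => y'.
  by rewrite eq_sym => /negbTE ->; rewrite mul0r.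
transitivity (\sum_x' \sum_y' (((c * (a x' * b y' * t x' y')
   + - (c * ((x == x')%:R * (b y' * t x' y')))) + - (c * ((y == y')%:R * (a x' * t x' y'))))
   + c * ((x == x')%:R * ((y == y')%:R * t x' y')))).
  rewrite !(sumD, sumN) !sumZ deltaX deltaY (deltaX (fun x' y' => (y == y')%:R * t x' y')).
  rewrite -/m -/r -/l (_ : \sum_y' (y == y')%:R * t x y' = t x y); first by ring.
  rewrite (bigD1 y) //= eqxx mul1r big1 ?addr0 // => y'.
  by rewrite eq_sym => /negbTE ->; rewrite mul0r.
apply: eq_bigr => x' _; apply: eq_bigr => y' _.
by rewrite -mulnb natrM /c; ring.
Qed.

(** The square root [(I - u u^T) diag(u)], [u = sqrt a], of [diag(a) - a a^T]. *)
Definition multinomial_root (X : finType) (a : X -> R) (x x' : X) : R :=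
  ((x == x')%:R - Num.sqrt (a x) * Num.sqrt (a x')) * Num.sqrt (a x').

Lemma multinomial_rootE (X : finType) (a : X -> R) (x' x'' : X) :
  (forall x, 0 <= a x) -> \sum_x a x = 1 ->
  \sum_x multinomial_root a x x' * multinomial_root a x x'' =
  (x' == x'')%:R * a x' - a x' * a x''.
Proof.
move=> a0 a1; pose u x := Num.sqrt (a x).
have uu x : u x * u x = a x by rewrite -expr2 sqr_sqrtr.
have delta (F : X -> R) y : \sum_x (x == y)%:R * F x = F y.
  by rewrite (bigD1 y) //= eqxx mul1r big1 ?addr0 // => x /negbTE ->; rewrite mul0r.
transitivity (\sum_x ((x == x')%:R * ((x == x'')%:R * (u x' * u x''))
   + (x == x')%:R * (- (u x * u x'' * u x' * u x''))
   + (x == x'')%:R * (- (u x * u x' * u x' * u x''))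
   + u x * u x * (u x' * u x' * u x'' * u x''))).
  by apply: eq_bigr => x _; rewrite /multinomial_root -!/(u _); ring.
rewrite !big_split /= !delta -mulr_suml.
rewrite (eq_bigr a) => [|x _]; last exact: uu.
rewrite a1 -(uu x') -(uu x''); case: eqP => [->|_] /=; ring.
Qed.

Variables (X Y Z : finType) (p : X -> Y -> Z -> R).
Hypothesis p_gt0 : forall x y z, 0 < p x y z.
Hypothesis pZ_gt0 : forall z, 0 < pZ p z.
Local Notation V := (X * Y * Z)%type.

Lemma pX_Z_ge0 x z : 0 <= pX_Z p x z.
Proof. by rewrite mulr_ge0 ?invr_ge0 ?(ltW (pZ_gt0 z)) // sumr_ge0 // => y _; rewrite ltW. Qed.

Lemma pY_Z_ge0 y z : 0 <= pY_Z p y z.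
Proof. by rewrite mulr_ge0 ?invr_ge0 ?(ltW (pZ_gt0 z)) // sumr_ge0 // => x _; rewrite ltW. Qed.

Lemma sum_pX_Z z : \sum_x pX_Z p x z = 1.
Proof. by rewrite -mulr_suml divff // gt_eqF //; exact: pZ_gt0. Qed.

Lemma sum_pY_Z z : \sum_y pY_Z p y z = 1.
Proof. by rewrite -mulr_suml exchange_big divff // gt_eqF //; exact: pZ_gt0. Qed.

Lemma sum_triple (F : V -> R) : \sum_v F v = \sum_z \sum_x \sum_y F (x, y, z).
Proof.
transitivity (\sum_(xy : X * Y) \sum_z F (xy, z)).
  by rewrite pair_bigA; apply: eq_bigr => -[].
rewrite exchange_big /=; apply: eq_bigr => z _.
by rewrite pair_bigA; apply: eq_bigr => -[].
Qed.

Definition sigma_triple (v v' : V) : R := sigma_entry p v.1.1 v.1.2 v.2 v'.1.1 v'.1.2 v'.2.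

Lemma sum_same_stratum (F : V -> R) z :
  (forall z' x' y', z != z' -> F (x', y', z') = 0) ->
  \sum_v' F v' = \sum_x' \sum_y' F (x', y', z).
Proof.
move=> F0; rewrite sum_triple (bigD1 z) //= [X in _ + X]big1 ?addr0 // => z' zz.
by apply: big1 => x' _; apply: big1 => y' _; rewrite F0 // eq_sym.
Qed.

(** [double_centring] in each stratum: the limit of the swap variances is the
    quadratic form of the covariance matrix. *)
Lemma limit_varE (t : V -> R) :
  limit_var p t = \sum_v \sum_v' t v * t v' * sigma_triple v v'.
Proof.
rewrite /limit_var !sum_triple big_distrr; apply: eq_bigr => z _ /=.
have pZ0 : pZ p z != 0 by rewrite gt_eqF.
transitivity (pZ p z * (4^-1 * \sum_x \sum_y \sum_x' \sum_y'
    pX_Z p x z * pY_Z p y z * (pX_Z p x' z * pY_Z p y' z) *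
    (t (x, y, z) + t (x', y', z) - t (x', y, z) - t (x, y', z)) ^+ 2)).
  rewrite mulrCA; congr (_ * _).
  rewrite big_distrr; apply: eq_bigr => x _; rewrite big_distrr; apply: eq_bigr => y _ /=.
  rewrite (@sum_same_stratum _ z); last first.
    by move=> z' x' y' /negbTE zz; rewrite /cross_diff2 /= zz !mul0r.
  rewrite big_distrr; apply: eq_bigr => x' _; rewrite big_distrr; apply: eq_bigr => y' _ /=.
  by rewrite /cross_diff2 /limit_prob /= eqxx /=; field.
rewrite (double_centring (fun x y => t (x, y, z)) (sum_pX_Z z) (sum_pY_Z z)).
rewrite big_distrr; apply: eq_bigr => x _; rewrite big_distrr; apply: eq_bigr => y _ /=.
rewrite (@sum_same_stratum _ z); last first.
  by move=> z' x' y' /negbTE zz; rewrite /sigma_triple /sigma_entry /= zz !mul0r mulr0.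
rewrite big_distrr; apply: eq_bigr => x' _; rewrite big_distrr; apply: eq_bigr => y' _ /=.
by rewrite /sigma_triple /sigma_entry /= eqxx /=; ring.
Qed.

(** In each stratum the covariance is the tensor product of two multinomial
    covariances, so the tensor product of their roots is a root of it. *)
Definition cov_root (v v' : V) : R :=
  (v.2 == v'.2)%:R * Num.sqrt (pZ p v.2) *
  multinomial_root (pX_Z p ^~ v.2) v.1.1 v'.1.1 * multinomial_root (pY_Z p ^~ v.2) v.1.2 v'.1.2.

Lemma cov_rootE v' v'' : \sum_v cov_root v v' * cov_root v v'' = sigma_triple v' v''.
Proof.
case: v' => [[x' y'] z']; case: v'' => [[x'' y''] z''].
rewrite sum_triple (bigD1 z') //= [X in _ + X]big1 ?addr0; last first.
  move=> z /negbTE zz; apply: big1 => x _; apply: big1 => y _.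
  by rewrite /cov_root /= zz !mul0r.
transitivity ((z' == z'')%:R * pZ p z' *
  ((\sum_x multinomial_root (pX_Z p ^~ z') x x' * multinomial_root (pX_Z p ^~ z') x x'') *
   (\sum_y multinomial_root (pY_Z p ^~ z') y y' * multinomial_root (pY_Z p ^~ z') y y''))).
  rewrite big_distrl big_distrr; apply: eq_bigr => x _ /=.
  rewrite mulrA big_distrr; apply: eq_bigr => y _ /=.
  rewrite /cov_root /= eqxx /=; have := sqr_sqrtr (ltW (pZ_gt0 z')).
  by set u := Num.sqrt _ => <-; ring.
rewrite !multinomial_rootE ?sum_pX_Z ?sum_pY_Z //; last first.
- by move=> x; exact: pX_Z_ge0.
- by move=> y; exact: pY_Z_ge0.
rewrite /sigma_triple /sigma_entry /= -mulnb natrM.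
case: (z' =P z'') => _ /=; last by rewrite !mul0r.
case: (x' =P x'') => [<-|_]; case: (y' =P y'') => [<-|_] /=; ring.
Qed.

End Covariance.

(** * The conditional law of the permuted table *)

Section ExactLaw.
Context (R : realType) (X Y Z : finType) (p : X -> Y -> Z -> R).
Hypothesis p_gt0 : forall x y z, 0 < p x y z.
Context (d : measure_display) (Om : measurableType d) (P : probability Om R).
Variable W : nat -> Om -> X * Y * Z.
Hypothesis W_iid : iid_copies P p W.
Variable tau : forall n : nat, Om -> 'S_n.
Hypothesis tau_rv : forall n, finite_rv (@tau n).
Hypothesis tau_cp : forall n, cond_dist P (seq_events W) (@tau n)
  (fun w => cp_uniform (sample W n w) R).

Let pv (v : X * Y * Z) : R := p v.1.1 v.1.2 v.2.

Lemma iid_law i v : P (W i @^-1` [set v]) = (pv v)%:E.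
Proof. by case: W_iid => _ h _; case: v => [[x y] z]; exact: h. Qed.

Lemma measure_partition (U : finType) (V : Om -> U) (A : set Om) (S : {set U}) :
  measurable A -> finite_rv V ->
  P (A `&` [set w | V w \in S]) = (\sum_(u in S) P (A `&` V @^-1` [set u]))%E.
Proof.
move=> mA mV; rewrite -big_enum /=.
have -> : [set w | V w \in S] = [set w | V w \in enum S].
  by apply/seteqP; split => w /=; rewrite mem_enum.
elim: (enum S) (enum_uniq S) => [|u s IH] /=.
  by rewrite big_nil (_ : _ `&` _ = set0) ?measure0 //; apply/seteqP; split => w //= [].
move=> /andP[us uniq_s]; rewrite big_cons -(IH uniq_s) -measureU.
- congr (P _); apply/seteqP; split => [w /= [Aw]|w /= [[Aw /= ->]|[Aw ws]]].
  + by rewrite inE => /orP[/eqP <-|]; [left|right].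
  + by split => //; rewrite mem_head.
  + by split => //; rewrite inE ws orbT.
- by apply: measurableI => //; exact: mV.
- apply: measurableI => //; rewrite (_ : [set w | _] = \bigcup_(u in [set` s]) V @^-1` [set u]).
    by apply: fin_bigcup_measurable => // v _; exact: mV.
  by apply/seteqP; split => [w ws|w [v /= vs ->]] //; exists (V w).
- by apply/seteqP; split => w //= [[_ ->] [_ us']]; rewrite us' in us.
Qed.

Lemma sampleE n (D : 'I_n -> X * Y * Z) w : sample_event W D w -> sample W n w = D.
Proof. by move=> h; apply/funext => i; rewrite /sample h. Qed.

(** On the event that the sample is [D] the conditional law of [tau n] is the
    constant uniform law of [D]. *)
Lemma prob_tau_sample n (D : 'I_n -> X * Y * Z) s :
  P (sample_event W D `&` @tau n @^-1` [set s]) = ((cp_uniform D R s)%:E * P (sample_event W D))%E.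
Proof.
have [W_rv _ W_ind] := W_iid; have [_ _ _ ->] := @tau_cp n; last first.
  exact: sample_event_sigma.
transitivity (\int[P]_(w in sample_event W D) (cp_uniform D R s)%:E)%E.
  by apply: eq_integral => w; rewrite inE => /sampleE ->.
by rewrite integral_cst //; exact: measurable_sample_event.
Qed.

Lemma prob_sample_gt0 n (D : 'I_n -> X * Y * Z) : 0 < fine (P (sample_event W D)).
Proof.
have [_ _ W_ind] := W_iid; rewrite (prob_sample_event iid_law) //=.
by apply: prodr_gt0 => i _; exact: p_gt0.
Qed.

Definition table_event n (D : 'I_n -> X * Y * Z) (k : X -> Y -> Z -> nat) : {set 'S_n} :=
  finset (fun s => [forall x, forall y, forall z, cp_count D s x y z == k x y z]).

Lemma cond_prob_table n (D : 'I_n -> X * Y * Z) (k : X -> Y -> Z -> nat) : (0 < n)%N ->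
  cond_prob P
    [set w | forall x y z, n%:R * phat_star (sample W n w) R (tau n w) x y z = (k x y z)%:R]
    [set w | forall i : 'I_n, W i w = D i] = #|cp_table D k|%:R / #|cp_perms D|%:R.
Proof.
move=> n0; rewrite -/(sample_event W D) /cond_prob.
have [W_rv _ W_ind] := W_iid.
have nR : (n%:R : R) != 0 by rewrite pnatr_eq0 -lt0n.
rewrite (_ : _ `&` _ = sample_event W D `&` [set w | tau n w \in table_event D k]); last first.
  have tabP w : sample_event W D w ->
      (forall x y z, n%:R * phat_star (sample W n w) R (tau n w) x y z = (k x y z)%:R) <->
      tau n w \in table_event D k.
    move=> Dw; rewrite (sampleE Dw) inE; split => h.
      apply/forallP => x; apply/forallP => y; apply/forallP => z.
      by have := h x y z; rewrite /phat_star mulVKf // => /eqP; rewrite eqr_nat.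
    move=> x y z; rewrite /phat_star mulVKf //; congr _%:R; apply/eqP.
    by move: h => /forallP/(_ x)/forallP/(_ y)/forallP/(_ z).
  by apply/seteqP; split => w /= [] h1 h2; split => //; [apply/(tabP w)|apply/(tabP w)].
rewrite measure_partition //; last exact: measurable_sample_event.
under eq_bigr do rewrite prob_tau_sample.
have [r r0 Pr] : exists2 r : R, 0 < r & P (sample_event W D) = r%:E.
  exists (fine (P (sample_event W D))); first exact: prob_sample_gt0.
  by rewrite fineK // (prob_sample_event iid_law).
rewrite Pr; under eq_bigr do rewrite -EFinM; rewrite sumEFin /= -mulr_suml mulfK ?gt_eqF //.
rewrite (bigID (mem (cp_perms D))) /= [X in _ + X]big1 ?addr0; last first.
  by move=> s /andP[_ /negbTE sP]; rewrite /cp_uniform sP.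
rewrite (eq_bigr (fun=> #|cp_perms D|%:R^-1)); last first.
  by move=> s /andP[_ sP]; rewrite /cp_uniform sP.
rewrite sumr_const -[LHS]mulr_natl; congr (_%:R * _); apply: eq_card => s.
apply/idP/cp_tableP; rewrite unfold_in.
  move=> /andP[+ sP]; rewrite inE => tb; split => // x y z; apply/eqP.
  by move: tb => /forallP/(_ x)/forallP/(_ y)/forallP/(_ z).
move=> [sP sk]; apply/andP; split => //; rewrite inE.
by apply/forallP => x; apply/forallP => y; apply/forallP => z; rewrite sk.
Qed.

Lemma cp_conditional_law n (D : 'I_n -> X * Y * Z) (k : X -> Y -> Z -> nat) : (0 < n)%N ->
  margins D k ->
  cond_prob P
    [set w | forall x y z, n%:R * phat_star (sample W n w) R (tau n w) x y z = (k x y z)%:R]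
    [set w | forall i : 'I_n, W i w = D i] =
  \prod_(z : Z) (((\prod_(x : X) (countXZ D x z)`!) * (\prod_(y : Y) (countYZ D y z)`!))%:R
     / ((countZ D z)`! * \prod_(xy : X * Y) (k xy.1 xy.2 z)`!)%:R).
Proof.
move=> n0 mk; rewrite cond_prob_table // card_cp_perms.
have fgt (A : finType) (F : A -> nat) : (0 < \prod_a (F a)`!)%N.
  by apply: prodn_gt0 => a; exact: fact_gt0.
rewrite prodf_div -!natr_prod -(card_cp_table mk) big_split /= !natrM invfM mulrACA.
rewrite divff ?mulr1 //; last by rewrite pnatr_eq0 -lt0n; apply: prodn_gt0 => z; exact: fgt.
Qed.

Lemma cp_conditional_law0 n (D : 'I_n -> X * Y * Z) (k : X -> Y -> Z -> nat) : (0 < n)%N ->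
  ~ margins D k ->
  cond_prob P
    [set w | forall x y z, n%:R * phat_star (sample W n w) R (tau n w) x y z = (k x y z)%:R]
    [set w | forall i : 'I_n, W i w = D i] = 0.
Proof.
move=> n0 mk; rewrite cond_prob_table // (_ : #|_| = 0%N) ?mul0r //.
apply: eq_card0 => s; apply/negP => /cp_tableP[sP sk]; apply: mk.
have := cp_count_margins sP; rewrite (_ : cp_count D s = k) //.
by apply/funext => x; apply/funext => y; apply/funext => z.
Qed.

End ExactLaw.

(** * The central limit theorem *)

Section CentralLimit.
Variables (R : realType) (X Y Z : finType) (p : X -> Y -> Z -> R).
Hypothesis p_gt0 : forall x y z, 0 < p x y z.
Hypothesis pZ_gt0 : forall z, 0 < pZ p z.
Local Notation V := (X * Y * Z)%type.
Local Notation l := #|{: X * Y * Z}|.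

Definition coord_fun (t : 'rV[R]_l) (v : V) : R := t 0 (enum_rank v).

Lemma sum_enum_val (F : V -> R) : \sum_(j < l) F (enum_val j) = \sum_v F v.
Proof.
rewrite [RHS](reindex (fun j : 'I_l => enum_val j)) //.
by apply: onW_bij; exact: enum_val_bij.
Qed.

Lemma dot_cp_stat n (D : 'I_n -> V) (s : 'S_n) (t : 'rV[R]_l) :
  dot (cp_stat D R s) t = cp_lin D (coord_fun t) s.
Proof.
rewrite /dot /cp_lin -(sum_enum_val (fun v => coord_fun t v * _)).
apply: eq_bigr => j _; rewrite mxE /coord_fun enum_valK mulrC; congr (_ * _).
by case: (enum_val j) => [[x y] z].
Qed.

Definition cov_factor : 'M[R]_(l, l) := \matrix_(i, j) cov_root p (enum_val i) (enum_val j).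

Lemma cov_factorE : cov_factor^T *m cov_factor = Sigma p.
Proof.
apply/matrixP => i j; rewrite !mxE.
transitivity (\sum_v cov_root p v (enum_val i) * cov_root p v (enum_val j)).
  by rewrite -sum_enum_val; apply: eq_bigr => m _; rewrite !mxE.
rewrite cov_rootE //.
by rewrite /sigma_triple; case: (enum_val i) => [[x y] z]; case: (enum_val j) => [[x' y'] z'].
Qed.

Lemma cov_factor_norm (t : 'rV[R]_l) :
  \sum_i (\sum_j cov_factor i j * t 0 j) ^+ 2 = limit_var p (coord_fun t).
Proof.
rewrite limit_varE // -sum_enum_val.
under [RHS]eq_bigr => i _ do rewrite -sum_enum_val.
transitivity (\sum_i \sum_j \sum_m (cov_factor m i * t 0 i) * (cov_factor m j * t 0 j)).
  under eq_bigr do rewrite expr2 big_distrlr /=.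
  rewrite exchange_big /=; apply: eq_bigr => i _.
  by rewrite exchange_big.
apply: eq_bigr => i _; apply: eq_bigr => j _.
rewrite -(cov_rootE p_gt0 pZ_gt0) -sum_enum_val big_distrr; apply: eq_bigr => m _ /=.
by rewrite !mxE /coord_fun !enum_valK; ring.
Qed.

Variable D : forall n, 'I_n -> V.
Hypothesis cvgX : forall x z, phatX_Z (@D n) R x z @[n --> \oo] --> pX_Z p x z.
Hypothesis cvgY : forall y z, phatY_Z (@D n) R y z @[n --> \oo] --> pY_Z p y z.
Hypothesis cvgZ : forall z, phatZ (@D n) R z @[n --> \oo] --> pZ p z.

(** The hypotheses of [cvg_bounded_continuous]: the stratified permutation
    yields the limit of the characteristic functions, and the coordinate
    functionals, being bounded by [1], have second moments at most [4]. *)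
Lemma cp_central_limit :
  cvg_law_normal (fun n => cp_uniform (@D n) R) (fun n => cp_stat (@D n) R) 0 (Sigma p).
Proof.
have [d [T [P [N [stdN cfN]]]]] := exists_std_normal_vector R l.
pose L w := (0 : 'rV[R]_l) + N w *m cov_factor.
have LE w j : L w 0 j = \sum_i N w 0 i * cov_factor i j by rewrite /L add0r mxE.
exists d, T, P, L; split.
  by exists l, cov_factor, N; split => //; exact: cov_factorE.
move=> f cf fM.
pose ell t theta := expR (- limit_var p (coord_fun t) / 2) * cos theta.
apply: (@cvg_bounded_continuous R l d T P L _ ell _ (fun n => 'S_n)
  (fun n => cp_uniform (@D n) R) (fun n => cp_stat (@D n) R) 4) => //.
- move=> j; under eq_fun do rewrite LE.
  apply: measurable_sum => i; apply: measurable_funM => //.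
  by case: stdN => mN _; exact: mN.
- move=> t theta; rewrite /ell -cov_factor_norm -cfN; apply: eq_integral => w _.
  congr ((cos (_ + _))%:E); rewrite /dot.
  under eq_bigr do rewrite LE mulr_suml.
  rewrite exchange_big; apply: eq_bigr => i _; rewrite big_distrr; apply: eq_bigr => j _ /=.
  by rewrite mulrA.
- by move=> n s; exact: cp_uniform_ge0.
- move=> n; rewrite -[RHS](cp_mean_cst (@D n) 1); apply: eq_bigr => s _; by rewrite mulr1.
- move=> n j n0; pose t : 'rV[R]_l := delta_mx 0 j.
  have t1 v : `|coord_fun t v| <= 1 by rewrite /coord_fun mxE normr_nat lern1 leq_b1.
  have := cp_lin_second_moment (@D n) n0 t1; rewrite expr1n mulr1; apply: le_trans.
  rewrite le_eqVlt; apply/orP; left; apply/eqP; apply: eq_bigr => s _.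
  rewrite -dot_cp_stat /dot (bigD1 j) //= /t.
  rewrite [delta_mx _ _ _ _]mxE !eqxx mulr1 big1 ?addr0 // => i /negbTE ij.
  by rewrite [delta_mx _ _ _ _]mxE ij andbF mulr0.
- move=> t theta; under eq_cvg do under eq_bigr do rewrite dot_cp_stat.
  exact: cvg_cp_char_fun.
Qed.

End CentralLimit.

Section FrequencyConvergence.
Context (R : realType) (X Y Z : finType) (p : X -> Y -> Z -> R).
Hypothesis pZ_gt0 : forall z, 0 < pZ p z.
Local Notation V := (X * Y * Z)%type.
Variable D : forall n, 'I_n -> V.
Hypothesis lln : forall g : V -> R, (\sum_i g (@D n i)) / n%:R @[n --> \oo] -->
  \sum_v p v.1.1 v.1.2 v.2 * g v.

Lemma cvg_phatZ z : phatZ (@D n) R z @[n --> \oo] --> pZ p z.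
Proof.
have := @lln (fun v => (v.2 == z)%:R); rewrite sum_triple (bigD1 z) //=.
rewrite [X in _ + X]big1 ?addr0; last first.
  by move=> z' /negbTE zz; apply: big1 => x _; apply: big1 => y _; rewrite zz mulr0.
rewrite eqxx (_ : \sum_x \sum_y p x y z * true%:R = pZ p z); last first.
  by apply: eq_bigr => x _; apply: eq_bigr => y _; rewrite mulr1.
by under [X in X @ _]eq_fun do rewrite -natr_sum.
Qed.

Lemma cvg_ratio (a b : nat -> nat) (u v : R) : v != 0 ->
  (a n)%:R / n%:R @[n --> \oo] --> u -> (b n)%:R / n%:R @[n --> \oo] --> v ->
  (a n)%:R / (b n)%:R @[n --> \oo] --> u / v.
Proof.
move=> v0 au bv.
have h : ((a n)%:R / n%:R) / ((b n)%:R / n%:R) @[n --> \oo] --> u / v.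
  by apply: cvgM => //; apply: cvgV.
apply: cvg_trans h; apply: near_eq_cvg; near=> n.
have n0 : (n%:R : R) != 0 by rewrite pnatr_eq0 -lt0n; near: n; exists 1%N.
by rewrite invf_div mulrA divfK.
Unshelve. all: by end_near. Qed.

Lemma cvg_phatX x z : phatX_Z (@D n) R x z @[n --> \oo] --> pX_Z p x z.
Proof.
apply: (@cvg_ratio (fun n => countXZ (@D n) x z) (fun n => countZ (@D n) z)
  (\sum_y p x y z) (pZ p z)); [by rewrite gt_eqF| |exact: cvg_phatZ].
have := @lln (fun v => ((v.1.1 == x) && (v.2 == z))%:R).
rewrite (_ : \sum_v _ = \sum_y p x y z).
  by under [X in X @ _]eq_fun do rewrite -natr_sum.
rewrite (@sum_same_stratum _ _ _ _ _ z); last first.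
  by move=> z' x' y' /negbTE zz; rewrite /= (eq_sym z') zz andbF mulr0.
rewrite (bigD1 x) //= [X in _ + X]big1 ?addr0; last first.
  by move=> x' /negbTE xx; apply: big1 => y _; rewrite xx mulr0.
by apply: eq_bigr => y _; rewrite !eqxx mulr1.
Qed.

Lemma cvg_phatY y z : phatY_Z (@D n) R y z @[n --> \oo] --> pY_Z p y z.
Proof.
apply: (@cvg_ratio (fun n => countYZ (@D n) y z) (fun n => countZ (@D n) z)
  (\sum_x p x y z) (pZ p z)); [by rewrite gt_eqF| |exact: cvg_phatZ].
have := @lln (fun v => ((v.1.2 == y) && (v.2 == z))%:R).
rewrite (_ : \sum_v _ = \sum_x p x y z).
  by under [X in X @ _]eq_fun do rewrite -natr_sum.
rewrite (@sum_same_stratum _ _ _ _ _ z); last first.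
  by move=> z' x' y' /negbTE zz; rewrite /= (eq_sym z') zz andbF mulr0.
apply: eq_bigr => x _; rewrite (bigD1 y) //= !eqxx mulr1 big1 ?addr0 // => y' /negbTE yy.
by rewrite yy mulr0.
Qed.
End FrequencyConvergence.

Theorem theorem2 (R : realType) (X Y Z : finType) (p : X -> Y -> Z -> R)
    (p_gt0 : forall x y z, 0 < p x y z)
    (p_sum1 : \sum_(x : X) \sum_(y : Y) \sum_(z : Z) p x y z = 1)
    (d : measure_display) (Om : measurableType d) (P : probability Om R)
    (W : nat -> Om -> X * Y * Z) (W_iid : iid_copies P p W)
    (tau : forall n : nat, Om -> 'S_n)
    (tau_rv : forall n, finite_rv (tau n))
    (tau_cp : forall n, cond_dist P (seq_events W) (tau n)
       (fun w => cp_uniform (sample W n w) R)) :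
  (forall (n : nat) (D : 'I_n -> X * Y * Z) (k : X -> Y -> Z -> nat),
    (0 < n)%N ->
    let cp := cond_prob P
      [set w | forall x y z,
         n%:R * phat_star (sample W n w) R (tau n w) x y z = (k x y z)%:R]
      [set w | forall i : 'I_n, W i w = D i] in
    (margins D k ->
      cp = \prod_(z : Z)
        (((\prod_(x : X) (countXZ D x z)`!)
            * (\prod_(y : Y) (countYZ D y z)`!))%:R
         / ((countZ D z)`! * \prod_(xy : X * Y) (k xy.1 xy.2 z)`!)%:R)) /\
    (~ margins D k -> cp = 0))
  /\
  (forall kappa : forall n : nat, Om -> 'S_n -> R,
    (forall n, cond_dist P (seq_events W) (tau n) (kappa n)) ->
    {ae P, forall w, cvg_law_normal (fun n => kappa n w)
                       (fun n => cp_stat (sample W n w) R) 0 (Sigma p)}).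
Proof.
split=> [n D k n0 cp|kappa kappa_cp].
  by split=> mk; [exact: cp_conditional_law|exact: cp_conditional_law0].
have [W_rv _ W_ind] := W_iid.
pose pv (v : X * Y * Z) := p v.1.1 v.1.2 v.2.
have pv1 : \sum_v pv v = 1.
  rewrite -p_sum1 -(pair_bigA _ (fun (xy : X * Y) z => p xy.1 xy.2 z)) /=.
  by rewrite -(pair_bigA _ (fun x y => \sum_z p x y z)).
have pZ_gt0 z : 0 < pZ p z.
  have XY : (0 < #|{: X * Y}|)%N.
    rewrite lt0n; apply/negP => /eqP XY0; have /eqP := pv1; rewrite big1 ?(eq_sym 0) ?oner_eq0 //.
    by move=> [xy z'] _; have := card0_eq XY0 xy; rewrite inE.
  rewrite /pZ pair_bigA /=; have /card_gt0P[xy _] := XY.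
  by rewrite (bigD1 xy) //= ltr_wpDr // sumr_ge0 // => ? _; rewrite ltW.
have aekappa : {ae P, forall w, forall n, kappa n w = cp_uniform (sample W n w) R}.
  apply/ae_foralln => n.
  have := cond_dist_unique (measurable_seq_events W_rv) (kappa_cp n) (tau_cp n).
  by apply: filterS => w h; apply/funext.
have aelln : {ae P, forall w, forall g : X * Y * Z -> R,
    (\sum_(i < n) g (sample W n w i)) / n%:R @[n --> \oo] --> \sum_v pv v * g v}.
  have : {ae P, forall w, forall v, sample_sum W n (fun u => (u == v)%:R) w / n%:R @[n --> \oo]
      --> \sum_u pv u * (u == v)%:R}.
    by apply: filter_forall => v; exact: (strong_law W_rv (iid_law W_iid) W_ind pv1).
  apply: filterS => w h g.
  rewrite (_ : (fun n => _) = fun n =>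
      \sum_v g v * (sample_sum W n (fun u => (u == v)%:R) w / n%:R)).
    apply: cvg_fsum => v; rewrite mulrC; apply: cvgM; first exact: cvg_cst.
    have := h v; rewrite (bigD1 v) //= eqxx mulr1 big1 ?addr0 // => u /negbTE ->.
    by rewrite mulr0.
  apply/funext => n; rewrite (sum_key (sample W n w)) mulr_suml; apply: eq_bigr => v _.
  by rewrite natr_sum [X in X / _]mulrC -mulrA.
apply: filterS2 aekappa aelln => w kE lln.
rewrite (_ : (fun n => kappa n w) = fun n => cp_uniform (sample W n w) R); last first.
  by apply: functional_extensionality_dep => n; exact: kE.
apply: (cp_central_limit p_gt0 pZ_gt0).
- by move=> x z; exact: cvg_phatX.
- by move=> y z; exact: cvg_phatY.
- by move=> z; exact: cvg_phatZ.
Qed.
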